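(* Let $r\geq 4$ be an even integer. Then there exist $\beta>0$ and $M>0$ such that for all integers $n\geq M$, $$|C_r(n)|\geq |M_r(n)|\,(1-2^{-\beta n}).$$
   Context: For an integer $r$, write $[r]=\{1,\ldots,r\}$ and $[i,j]=\{i,i+1,\ldots,j\}$. An $r$-graph is a pair $G=(V,c)$ with $V$ a set and $c:\binom{V}{2}\to 2^{[r]}$ (here $\binom{V}{2}$ is the set of 2-element subsets of $V$, written $xy$). It is simple if $|c(e)|\leq 1$ for all $e$ and complete if $c(e)\neq\emptyset$ for all $e$; for a simple complete $r$-graph, $d^G(x,y)$ denotes the unique element of $c(xy)$. For integers $n,r\geq 3$, $M_r(n)$ is the set of simple complete $r$-graphs $G=([n],c)$ such that $d^G(x,z)\leq d^G(x,y)+d^G(y,z)$ for all pairwise distinct $x,y,z\in[n]$ (metric spaces on $[n]$ with distances in $[r]$). For even $r\geq 4$, $C_r(n)$ is the set of all simple complete $r$-graphs $G=([n],c)$ with $c(e)\subseteq[\frac r2,r]$ for all $e\in\binom{[n]}{2}$. *)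

(* Defs.v *)
From HB Require Import structures.
From mathcomp Require Import all_boot.

Set Implicit Arguments.
Unset Strict Implicit.
Unset Printing Implicit Defensive.

Definition edge (V : finType) := {e : {set V} | #|e| == 2}.

(* The ordinal k : 'I_r stands for the colour k + 1, so that 'I_r is [r]. *)
Definition colour_val (r : nat) (k : 'I_r) : nat := k.+1.

(* [i, j], seen as a subset of [r] *)
Definition colour_itv (r i j : nat) : {set 'I_r} :=
  [set k : 'I_r | i <= colour_val k <= j].

Definition rgraph (r : nat) (V : finType) := {ffun edge V -> {set 'I_r}}.

Definition rg_simple (r : nat) (V : finType) (G : rgraph r V) : bool :=
  [forall e : edge V, #|G e| <= 1].

Definition rg_complete (r : nat) (V : finType) (G : rgraph r V) : bool :=
  [forall e : edge V, G e != set0].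

(* c(xy), with the dummy value set0 when x = y *)
Definition rg_colours (r : nat) (V : finType) (G : rgraph r V) (x y : V) :
    {set 'I_r} :=
  if insub [set x; y] is Some e then G e else set0.

(* Meaningful when G is simple and complete and x != y: c(xy) is then a
   singleton, so that the element picked is the only one. *)
Definition rg_dist (r : nat) (V : finType) (G : rgraph r V) (x y : V) : nat :=
  if [pick k in rg_colours G x y] is Some k then colour_val k else 0.

Definition metric_rgraphs (r n : nat) : {set rgraph r 'I_n} :=
  [set G : rgraph r 'I_n |
    [&& rg_simple G, rg_complete G &
      [forall x, forall y, forall z,
        [&& x != y, y != z & x != z] ==>
          (rg_dist G x z <= rg_dist G x y + rg_dist G y z)]]].

Definition upper_rgraphs (r n : nat) : {set rgraph r 'I_n} :=
  [set G : rgraph r 'I_n |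
    [&& rg_simple G, rg_complete G &
      [forall e : edge 'I_n, G e \subset colour_itv r r./2 r]]].

(* Main.v *)
(* Write r = 2m and s = m + 1. If all triples in A x B x C are metric, then comparing
   minima and maxima gives |A| + |B| + |C| <= 3s, hence |A||B||C| <= s^3, and s
   drops to s - 1 when the colours are at most r - 2. A container argument with
   fingerprints of bounded size turns this into a count: if at least delta n edges
   at some vertex have colour below m, all distances between their other ends are
   at most r - 2, so there are at most 2^(-n) s^C(n,2) such metrics. Otherwise an
   edge xy of colour below m forces the pairs (d(x,z), d(y,z)) to avoid one of the
   s^2 values in [m, r]^2 for all but few z, so the number f(n) of metrics
   satisfies f(n) / s^C(n,2) <= 1 + 2^(-n) + e^(-b n) f(n-2) / s^C(n-2,2). *)

Require Import Defs.
From mathcomp Require Import all_boot all_order all_algebra.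
From mathcomp Require Import reals sequences exp.
From mathcomp Require Import zify ring lra.

Set Implicit Arguments.
Unset Strict Implicit.
Unset Printing Implicit Defensive.

(** Containers lose a factor exp(eps n^2), far more than the precision 2^(-beta n) allows, so they
    serve only where the saving is itself quadratic: at a vertex with linearly many short edges.
    That saving also pays for the 2^n choices of the set [Z] of their other ends. A lone short edge
    saves only exp(-b n); its case is therefore an exact comparison with the metrics on the other n
    - 2 points, where the absence of crowded vertices keeps both ends of the edge at distance at
    least m from almost all points.

    The triangle condition is 3-uniform on pairs (edge, colour). Boundedly many profiles d(x, .)
    lower the uniformity: they already exclude nearly all that any other profile excludes on the
    edges yz. For each x the profile then spans few edges of an ordinary graph on pairs (vertex,
    colour), where a greedy fingerprint works.

    Evenness of r makes 3 (r + 2) / 2 equal to 3 s with s an integer, the number of colours in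
    [m, 2m]. *)

(* The set S maximises a * #|covered| - b * #|S|. *)
Lemma greedy_cover (I E : finType) (kill : I -> {set E}) (D : {set I})
    (a b : nat) :
  exists S : {set I}, [/\ S \subset D, b * #|S| <= a * #|E| &
    forall u, u \in D ->
      a * #|kill u :\: \bigcup_(w in S) kill w| <= b].
Proof.
pose cov (S : {set I}) := \bigcup_(w in S) kill w.
(* The added constant [b * #|I|] keeps the potential a natural number. *)
pose pot (S : {set I}) := a * #|cov S| + b * (#|I| - #|S|).
have h0 : (set0 : {set I}) \subset D by rewrite sub0set.
case: (@arg_maxnP _ set0 (fun S : {set I} => S \subset D) pot h0) => S SD Smax.
exists S; split=> //.
- have := Smax _ h0; rewrite /pot /cov big_set0 !cards0 muln0 add0n subn0.
  have hE : #|cov S| <= #|E| by apply: max_card.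
  have hI : #|S| <= #|I| by apply: max_card.
  move: (leq_mul (leqnn a) hE) (leq_mul (leqnn b) hI); rewrite /cov mulnBr /=.
 lia.
- move=> u uD; case: (boolP (u \in S)) => uS.
    have -> : kill u :\: \bigcup_(w in S) kill w = set0.
      by apply/eqP; rewrite setD_eq0; apply: bigcup_sup.
    by rewrite cards0 muln0.
  have h1 : u |: S \subset D by rewrite subUset sub1set uD SD.
  have := Smax _ h1; rewrite /pot /cov bigcup_setU big_set1 cardsU1 uS /=.
  have hI : #|u |: S| <= #|I| by apply: max_card.
  rewrite cardsU1 uS /= in hI.
  have -> : #|kill u :|: cov S| = #|kill u :\: cov S| + #|cov S|.
    rewrite cardsU cardsD.
    have := subset_leq_card (subsetIl (kill u) (cov S)); lia.
  move: (leq_mul (leqnn b) hI); rewrite /cov !mulnDr !mulnBr !mulnDr /=; lia.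
Qed.

(** Such a set is a word of length J over [option I]: its enumeration, padded with [None]. *)
Lemma card_small_sets (I : finType) (J : nat) :
  #|[set S : {set I} | #|S| <= J]| <= #|I|.+1 ^ J.
Proof.
pose g (f : {ffun 'I_J -> option I}) : {set I} :=
  [set u | [exists i, f i == Some u]].
have hsub : [set S : {set I} | #|S| <= J] \subset
    g @: [set: {ffun 'I_J -> option I}].
  apply/subsetP => S; rewrite inE => hS; apply/imsetP.
  exists [ffun i : 'I_J => nth None (map Some (enum S)) i]; first by rewrite inE.
  apply/setP => u; rewrite inE; apply/idP/existsP.
    move=> uS.
    have hi : index u (enum S) < #|S| by rewrite cardE index_mem mem_enum.
    exists (Ordinal (leq_trans hi hS)); rewrite ffunE /=.
    rewrite (nth_map u); last by rewrite -cardE.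
    by rewrite nth_index ?mem_enum.
  case=> i; rewrite ffunE => /eqP hi.
  case: (ltnP i #|S|) => hiS.
    move: hi; rewrite (nth_map u) -?cardE // => -[<-].
    by rewrite -mem_enum mem_nth // -cardE.
  by move: hi; rewrite nth_default // size_map -cardE.
apply: leq_trans (subset_leq_card hsub) _.
apply: leq_trans (leq_imset_card _ _) _.
by rewrite cardsT card_ffun card_option card_ord.
Qed.

(** * Triangles of colours and elementary counting *)

Definition tri (a b c : nat) : bool := [&& a <= b + c, b <= a + c & c <= a + b].

(* With minima a0, b0, c0, each set is confined both by the cap t and by the
   sum of the other two minima; the average of the two bounds is free of the
   minima. *)
Lemma card_tri_sets (r t : nat) (A B C : {set 'I_r}) :
    A != set0 -> B != set0 -> C != set0 ->
    (forall a b c : 'I_r, a \in A -> b \in B -> c \in C -> tri a b c) ->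
    (forall a : 'I_r, a \in A -> a <= t) ->
    (forall b : 'I_r, b \in B -> b <= t) ->
    (forall c : 'I_r, c \in C -> c <= t) ->
  2 * (#|A| + #|B| + #|C|) <= 3 * (t + 2).
Proof.
move=> /set0Pn [a aA] /set0Pn [b bB] /set0Pn [c cC] htri hA hB hC.
pose v (i : 'I_r) := nat_of_ord i.
have card_itv (D : {set 'I_r}) (lo hi : nat) : lo <= hi.+1 ->
    (forall i : 'I_r, i \in D -> lo <= i <= hi) -> #|D| + lo <= hi + 1.
  move=> hlo hD.
  have : #|D| <= size (iota lo (hi.+1 - lo)).
    rewrite cardE -(size_map v); apply: uniq_leq_size.
      by rewrite map_inj_uniq ?enum_uniq //; apply: val_inj.
    move=> x /mapP [i]; rewrite mem_enum => /hD hi' ->.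
    by rewrite mem_iota /v; lia.
  rewrite size_iota; lia.
case: (arg_minnP v aA) => a0 a0A mA.
case: (arg_minnP v bB) => b0 b0B mB.
case: (arg_minnP v cC) => c0 c0C mC.
have A1 := card_itv A a0 t (leqW (hA _ a0A)) (fun i hi =>
  introT andP (conj (mA i hi) (hA i hi))).
have B1 := card_itv B b0 t (leqW (hB _ b0B)) (fun i hi =>
  introT andP (conj (mB i hi) (hB i hi))).
have C1 := card_itv C c0 t (leqW (hC _ c0C)) (fun i hi =>
  introT andP (conj (mC i hi) (hC i hi))).
have h0 := htri _ _ _ a0A b0B c0C; move: h0; rewrite /tri => /and3P [h1 h2 h3].
have A2 : #|A| + a0 <= b0 + c0 + 1.
  apply: card_itv; first by rewrite leqW.
  by move=> i hi; have := htri _ _ _ hi b0B c0C; have := mA _ hi; rewrite /tri /v; lia.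
have B2 : #|B| + b0 <= a0 + c0 + 1.
  apply: card_itv; first by rewrite leqW.
  by move=> i hi; have := htri _ _ _ a0A hi c0C; have := mB _ hi; rewrite /tri /v; lia.
have C2 : #|C| + c0 <= a0 + b0 + 1.
  apply: card_itv; first by rewrite leqW.
  by move=> i hi; have := htri _ _ _ a0A b0B hi; have := mC _ hi; rewrite /tri /v; lia.
lia.
Qed.

Lemma agm3 (x y z t : nat) : x + y + z <= 3 * t -> x * y * z <= t ^ 3.
Proof.
(* With u the smallest variable no subtraction occurs: the cube exceeds 27 times the product by 9 u
   (p^2 - p q + q^2) + (p + q)^3. *)
have agm_min u p q : 27 * (u * (u + p) * (u + q)) <= (u + (u + p) + (u + q)) ^ 3.
  have upq : u * (p * q) <= u * (p * p) + u * (q * q).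
    by have [pq _] := nat_Cauchy p q; rewrite -mulnDr leq_mul // !mulnn; lia.
  suff : (u + (u + p) + (u + q)) ^ 3 + 9 * (u * (p * q)) =
      27 * (u * (u + p) * (u + q)) +
      (9 * (u * (p * p) + u * (q * q)) + (p + q) ^ 3) by lia.
  by rewrite !expnS !expn0 !muln1; lia.
have agm_le u v w : u <= v -> u <= w -> 27 * (u * v * w) <= (u + v + w) ^ 3.
  by move=> uv uw; have := agm_min u (v - u) (w - u); rewrite !subnKC.
have key : 27 * (x * y * z) <= (x + y + z) ^ 3.
  have [xy|/ltnW yx] := leqP x y; have [xz|/ltnW zx] := leqP x z.
  - exact: agm_le.
  - have := agm_le z x y zx (leq_trans zx xy).
    by rewrite -mulnA [z * _]mulnC -addnA [z + _]addnC.
  - have := agm_le y x z yx (leq_trans yx xz).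
    by rewrite [y * x]mulnC [y + x]addnC.
  have [yz|/ltnW zy] := leqP y z.
    by have := agm_le y x z yx yz; rewrite [y * x]mulnC [y + x]addnC.
  have := agm_le z x y zx zy.
  by rewrite -mulnA [z * _]mulnC -addnA [z + _]addnC.
move=> h; have h3 : (x + y + z) ^ 3 <= (3 * t) ^ 3 by rewrite leq_exp2r.
have := leq_trans key h3; rewrite expnMn; lia.
Qed.

Lemma tri_swapl (a b c : nat) : tri a b c = tri b a c.
Proof. by rewrite /tri; lia. Qed.

Lemma tri_swapr (a b c : nat) : tri a b c = tri a c b.
Proof. by rewrite /tri; lia. Qed.

Lemma card_pairs (T U : finType) (P : T -> U -> bool) :
  #|[set p : T * U | P p.1 p.2]| = \sum_(x : T) #|[set y | P x y]|.
Proof.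
rewrite -sum1_card (eq_bigl (fun p : T * U => true && P p.1 p.2)); last by move=> p; rewrite inE.
rewrite -(pair_big_dep (fun=> true) P (fun _ _ => 1)) /=.
by apply: eq_bigr => x _; rewrite -sum1_card; apply: eq_bigl => y; rewrite inE.
Qed.

Lemma markov_card (T : finType) (D : {set T}) (g : T -> nat) (k s : nat) :
  \sum_(x in D) g x <= s -> #|[set x in D | k < g x]| * k <= s.
Proof.
move=> hs; apply: leq_trans hs.
rewrite -sum_nat_const [leqRHS](bigID (fun x => k < g x)) /=.
apply: leq_trans (leq_addr _ _).
rewrite [leqRHS](eq_bigl (fun x => x \in [set x in D | k < g x])); last first.
  by move=> x; rewrite inE.
by apply: leq_sum => x; rewrite inE => /andP [_ /ltnW].
Qed.

(** * Containers for the profiles of a metric *)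

Section Containers.
Variables (n r : nat).
Local Notation V := 'I_n.
Local Notation K := 'I_r.+1.
Implicit Types (x y z : V) (u w : V * K) (Phi : {set {ffun V -> K}}).

Definition cand Phi y z : {set K} :=
  [set c : K | [forall phi in Phi, tri c (phi y) (phi z)]].

Lemma candC Phi y z : cand Phi y z = cand Phi z y.
Proof. by apply/setP => c; rewrite !inE; apply: eq_forallb => phi; rewrite tri_swapr. Qed.

(** A pair (y, b) is the guess d(x, y) = b for a vertex x in the background. One open colour of yz
    that breaks the triangle is enough for a conflict, so guesses without conflict fit every colour
    still open on yz. *)
Definition conflict Phi u w : bool :=
  [exists c in cand Phi u.1 w.1, ~~ tri c u.2 w.2].

Definition nbr Phi u : {set V * K} := [set w | conflict Phi u w].

Definition free Phi (S : {set V * K}) : {set V * K} :=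
  ~: \bigcup_(u in S) nbr Phi u.

(* The container of the almost independent sets with fingerprint S: it spans few
   conflicts because every vertex of high degree in free Phi S is dropped. *)
Definition core Phi (a : nat) (S : {set V * K}) : {set V * K} :=
  [set u in free Phi S | a * #|nbr Phi u :&: free Phi S| <= n].

Lemma card_core_edges Phi a S :
  a * #|[set p : (V * K) * (V * K) |
         [&& p.1 \in core Phi a S, p.2 \in core Phi a S & conflict Phi p.1 p.2]]|
    <= n ^ 2 * r.+1.
Proof.
rewrite (card_pairs (fun u w => [&& u \in core Phi a S, w \in core Phi a S & conflict Phi u w])).
rewrite big_distrr /=.
apply: (@leq_trans (\sum_(u : V * K) n)); last first.
  by rewrite sum_nat_const card_prod !card_ord -mulnA [r.+1 * n]mulnC mulnA -mulnn.
apply: leq_sum => u _; case: (boolP (u \in core Phi a S)) => /= [|_]; last first.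
  by rewrite (_ : [set _ | _] = set0) ?cards0 ?muln0 //; apply/setP => w; rewrite !inE.
rewrite inE => /andP [_]; apply: leq_trans; rewrite leq_mul2l subset_leq_card ?orbT //.
by apply/subsetP => w; rewrite !inE => /andP [/andP [-> _] ->].
Qed.

Definition profile (d : {ffun V * V -> K}) x : {ffun V -> K} :=
  [ffun y => d (x, y)].

Definition clash Phi (phi : {ffun V -> K}) : {set V * V * K} :=
  [set p | (p.2 \in cand Phi p.1.1 p.1.2) && ~~ tri p.2 (phi p.1.1) (phi p.1.2)].

(* Boundedly many profiles d(x, .) pin down, up to o(n^2), everything that any single
   profile forbids about the colours of the other pairs. *)
Lemma profiles_fingerprint (d : {ffun V * V -> K}) a : 0 < n ->
  exists Phi, [/\ Phi \subset [set profile d x | x : V], #|Phi| <= a * r.+1 &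
    forall x, a * #|clash Phi (profile d x)| <= n ^ 2].
Proof.
move=> n0.
pose kill (phi : {ffun V -> K}) := [set p : V * V * K | ~~ tri p.2 (phi p.1.1) (phi p.1.2)].
have [Phi [sub small gr]] := greedy_cover kill [set profile d x | x : V] a (n ^ 2).
exists Phi; split=> //.
  move: small; rewrite !card_prod !card_ord mulnn mulnCA leq_pmul2l //.
  by rewrite expn_gt0 n0.
move=> x; apply: leq_trans (gr (profile d x) _); last by apply: imset_f.
rewrite leq_mul2l subset_leq_card ?orbT //.
apply/subsetP => p; rewrite !inE => /andP [/forall_inP h ->]; rewrite andbT.
by apply/bigcupP => -[phi /h]; rewrite inE => ->.
Qed.

Definition graph_of (phi : {ffun V -> K}) : {set V * K} := [set u | phi u.1 == u.2].

(** In the graph of a function a vertex y carries a single colour, so a conflict is determined by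
    its pair (y, z), and the colour witnessing it completes an element of [clash]. *)
Lemma card_graph_conflicts Phi (phi : {ffun V -> K}) :
  \sum_(u in graph_of phi) #|nbr Phi u :&: graph_of phi| <= #|clash Phi phi|.
Proof.
pose E := [set p : (V * K) * (V * K) |
  [&& p.1 \in graph_of phi, p.2 \in graph_of phi & conflict Phi p.1 p.2]].
have -> : \sum_(u in graph_of phi) #|nbr Phi u :&: graph_of phi| = #|E|.
  rewrite (card_pairs (fun u w => [&& u \in graph_of phi, w \in graph_of phi & conflict Phi u w])).
  rewrite big_mkcond /=; apply: eq_bigr => u _.
  case: (u \in graph_of phi); last first.
    by rewrite (_ : [set _ | _] = set0) ?cards0 //; apply/setP => w; rewrite !inE.
  by apply: eq_card => w; rewrite !inE andbC.
pose f (p : V * V * K) := ((p.1.1, phi p.1.1), (p.1.2, phi p.1.2)).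
apply: leq_trans (leq_imset_card f _); apply: subset_leq_card.
apply/subsetP => -[[y b] [z c]]; rewrite !inE /= => /and3P [/eqP hb /eqP hc].
case/exists_inP => /= t tc ht; apply/imsetP; exists ((y, z), t).
  by rewrite inE /= tc hb hc.
by rewrite /f /= hb hc.
Qed.

(** By Markov, at most n / (2 e) vertices of the graph have more than n / b conflicts inside it; [S]
    is chosen greedily among the others. A vertex of the graph outside the core is either one of
    these high ones or a neighbour of [S], and the at most a (r + 1) elements of [S], with at most n
    / b neighbours in the graph each, account for n / (2 e) more. *)
Lemma core_fingerprint Phi (phi : {ffun V -> K}) (a e : nat) : 0 < n -> 0 < a ->
    2 * e * (2 * e * (a * r.+1)) * #|clash Phi phi| <= n ^ 2 ->
  exists S : {set V * K}, #|S| <= a * r.+1 /\ e * #|graph_of phi :\: core Phi a S| <= n.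
Proof.
move=> n0 a0 hclash.
pose b := 2 * e * (a * r.+1); pose G := graph_of phi.
pose deg u := #|nbr Phi u :&: G|.
pose high := [set u in G | n < b * deg u].
have hhigh : 2 * e * #|high| <= n.
  have : #|high| * n <= b * #|clash Phi phi|.
    apply: markov_card; rewrite -big_distrr /= leq_mul2l.
    by rewrite card_graph_conflicts orbT.
  move/(leq_mul (leqnn (2 * e))); rewrite !mulnA => h.
  rewrite -(leq_pmul2r n0) mulnn; apply: leq_trans h _.
  by apply: leq_trans hclash; rewrite /b !mulnA.
have [S [sub small gr]] := greedy_cover (nbr Phi) (G :\: high) a n.
have hS : #|S| <= a * r.+1.
  by move: small; rewrite card_prod !card_ord mulnCA leq_pmul2l.
exists S; split=> //.
pose X := \sum_(u in S) deg u.
have hX : 2 * e * X <= n.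
  have h : b * X <= a * r.+1 * n.
    apply: (@leq_trans (#|S| * n)); last by rewrite leq_mul2r hS orbT.
    rewrite /X big_distrr /= -sum_nat_const; apply: leq_sum => u /(subsetP sub).
    by rewrite in_setD => /andP [+ uG]; rewrite inE uG /= -leqNgt.
  rewrite -(@leq_pmul2l (a * r.+1)) ?muln_gt0 ?a0 //.
  by apply: leq_trans h; rewrite /b mulnCA mulnA.
have hcov : #|G :\: core Phi a S| <= #|high| + X.
  apply: (@leq_trans #|high :|: \bigcup_(u in S) (nbr Phi u :&: G)|).
    apply: subset_leq_card; apply/subsetP => v; rewrite inE => /andP [vC vG].
    rewrite in_setU; case: (boolP (v \in high)) => //= vh.
    rewrite -big_distrl /= in_setI vG andbT; apply: contraR vC => vU.
    have vD : v \in G :\: high by rewrite in_setD vh.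
    by rewrite inE in_setC vU /=; have := gr v vD; rewrite setDE.
  apply: leq_trans (leq_card_setU _ _) _; rewrite leq_add2l.
  rewrite /X /deg; elim/big_rec2: _ => [|u k A _ IH]; first by rewrite cards0.
  by apply: leq_trans (leq_card_setU _ _) _; rewrite leq_add2l.
have := leq_mul (leqnn (2 * e)) hcov; rewrite mulnDr -/G; lia.
Qed.

(** Asking for the core of x and for that of y makes the container symmetric, as products over
    unordered pairs require. *)
Definition cont Phi a (S : V -> {set V * K}) (Z : {set V}) (t : nat) x y : {set K} :=
  [set c in cand Phi x y | [&& (y, c) \in core Phi a (S x), (x, c) \in core Phi a (S y)
     & (x \in Z) && (y \in Z) ==> (c <= t)]].

Lemma in_cont Phi a S Z t x y c : (c \in cont Phi a S Z t x y) =
  [&& c \in cand Phi x y, (y, c) \in core Phi a (S x), (x, c) \in core Phi a (S y)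
     & (x \in Z) && (y \in Z) ==> (c <= t)].
Proof. by rewrite in_set. Qed.

Lemma contC Phi a S Z t x y : cont Phi a S Z t x y = cont Phi a S Z t y x.
Proof. apply/setP => c; rewrite !in_cont candC [(x \in Z) && _]andbC.
by congr andb; rewrite andbCA. Qed.

Definition bad_triple Phi a S Z t x y z : bool :=
  [exists b in cont Phi a S Z t x y, exists c in cont Phi a S Z t x z,
     exists k in cont Phi a S Z t y z, ~~ tri b c k].

(** For fixed x a bad triple is an edge inside the core of x: the colour k of yz is still a
    candidate, and it witnesses the conflict between (y, b) and (z, c). *)
Lemma card_bad_triples Phi a S Z t :
  a * #|[set p : V * (V * V) | bad_triple Phi a S Z t p.1 p.2.1 p.2.2]| <= n ^ 3 * r.+1.
Proof.
rewrite (card_pairs (fun x (p : V * V) => bad_triple Phi a S Z t x p.1 p.2)).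
rewrite big_distrr /=.
apply: (@leq_trans (\sum_(x : V) n ^ 2 * r.+1)); last first.
  by rewrite sum_nat_const card_ord mulnA -expnS.
apply: leq_sum => x _; apply: leq_trans (card_core_edges Phi a (S x)).
rewrite leq_mul2l; apply/orP; right.
pose f (p : (V * K) * (V * K)) := (p.1.1, p.2.1).
apply: leq_trans (leq_imset_card f _); apply: subset_leq_card.
apply/subsetP => -[y z]; rewrite inE /= => /exists_inP [b hb] /exists_inP [c hc] /exists_inP [k hk ht].
apply/imsetP; exists ((y, b), (z, c)) => //; rewrite in_set /=.
move: hb hc hk; rewrite !in_cont => /and4P [_ -> _ _] /and4P [_ -> _ _] /and4P [hk _ _ _].
apply/exists_inP; exists k => //=.
by rewrite tri_swapl tri_swapr tri_swapl; move: ht; rewrite /tri; lia.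
Qed.
End Containers.

(** * Products over triples and the container bound *)

Lemma prod_tri_sets (r t h L : nat) (A B C : {set 'I_r}) :
    t + 2 = 2 * h -> 0 < h -> 0 < r -> 4 * r ^ 3 <= L ->
    (forall a b c : 'I_r, a \in A -> b \in B -> c \in C -> tri a b c) ->
    (forall a : 'I_r, a \in A -> a <= t) ->
    (forall b : 'I_r, b \in B -> b <= t) ->
    (forall c : 'I_r, c \in C -> c <= t) ->
  (L * #|A| + r) * (L * #|B| + r) * (L * #|C| + r) <= (L * h + r) ^ 3.
Proof.
move=> th h0 r0 hL htri hA hB hC.
have cardr (D : {set 'I_r}) : #|D| <= r by rewrite -[X in _ <= X]card_ord max_card.
(* The bound on sizes needs nonempty sets. An empty one leaves the factor r beside two factors of at
   most 2 L r, and r (2 L r)^2 <= L^3 is exactly the condition [4 * r ^ 3 <= L]. *)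
have empty u v : u <= r -> v <= r -> r * ((L * u + r) * (L * v + r)) <= (L * h + r) ^ 3.
  move=> ur vr.
  have rL : 1 <= L by apply: leq_trans hL; rewrite muln_gt0 expn_gt0 r0.
  have wb w : w <= r -> L * w + r <= 2 * (L * r).
    by move=> wr; rewrite mulSn mul1n leq_add ?leq_mul2l ?wr ?orbT // leq_pmull.
  apply: (@leq_trans (L ^ 3)); last first.
    by rewrite leq_exp2r //; apply: leq_trans (leq_addr _ _); rewrite leq_pmulr.
  apply: (@leq_trans (r * ((2 * (L * r)) * (2 * (L * r))))).
    by rewrite leq_mul2l leq_mul ?wb ?orbT.
  rewrite (_ : r * _ = (4 * r ^ 3) * (L * L)); last by rewrite !expnS expn0 muln1; lia.
  by rewrite (_ : L ^ 3 = L * (L * L)) ?leq_mul2r ?hL ?orbT // !expnS expn0 muln1.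
have [->|A0] := eqVneq A set0; first by rewrite cards0 muln0 add0n -mulnA empty.
have [->|B0] := eqVneq B set0; first by rewrite cards0 muln0 add0n -mulnA mulnCA empty.
have [->|C0] := eqVneq C set0; first by rewrite cards0 muln0 add0n mulnC empty.
apply: agm3; have := card_tri_sets A0 B0 C0 htri hA hB hC; rewrite th => hs.
have hs' : #|A| + #|B| + #|C| <= 3 * h by lia.
have := leq_mul (leqnn L) hs'; rewrite !mulnDr; lia.
Qed.

Lemma upper_pairs_prod n (w : 'I_n -> 'I_n -> nat) : (forall x y, w x y = w y x) ->
  \prod_(x < n) \prod_(y < n) (if x == y then 1 else w x y) =
  (\prod_(p : 'I_n * 'I_n | p.1 < p.2) w p.1 p.2) ^ 2.
Proof.
move=> wC; rewrite pair_big /=.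
rewrite (bigID (fun p : 'I_n * 'I_n => p.1 < p.2)) /= -mulnn; congr (_ * _).
  by apply: eq_bigr => p; case: eqP => [->|//]; rewrite ltnn.
rewrite (bigID (fun p : 'I_n * 'I_n => p.2 < p.1)) /= [X in _ * X]big1 ?muln1; last first.
  by move=> p hp; rewrite (_ : p.1 == p.2) //; apply/eqP/val_inj => /=; lia.
pose sw (p : 'I_n * 'I_n) := (p.2, p.1).
rewrite (reindex_inj (h := sw)) /=; last by move=> [a b] [c d] [-> ->].
apply: eq_big => p; first by lia.
by move=> hp; rewrite wC; case: eqP => // e; move: hp; rewrite e ltnn andbF.
Qed.

Lemma expn_prod (I : finType) (P : pred I) (F : I -> nat) k :
  \prod_(i | P i) F i ^ k = (\prod_(i | P i) F i) ^ k.
Proof. by rewrite (big_morph (expn^~ k) (id1 := 1) (op1 := muln)) // => [a b|]; rewrite ?expnMn ?exp1n. Qed.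

(** Each ordered pair occurs in three positions, with n choices of the third vertex. Together with
    the square in [upper_pairs_prod] this yields the exponent [6 * n] used below. *)
Lemma triples_prod n (w : 'I_n -> 'I_n -> nat) :
  \prod_(p : 'I_n * ('I_n * 'I_n)) (w p.1 p.2.1 * w p.1 p.2.2 * w p.2.1 p.2.2) =
  (\prod_(x < n) \prod_(y < n) w x y) ^ (3 * n).
Proof.
have split3 : \prod_(p : 'I_n * ('I_n * 'I_n)) (w p.1 p.2.1 * w p.1 p.2.2 * w p.2.1 p.2.2) =
  \prod_(x < n) \prod_(y < n) \prod_(z < n) (w x y * w x z * w y z).
  rewrite (eq_bigr (fun x => \prod_(p : 'I_n * 'I_n) (w x p.1 * w x p.2 * w p.1 p.2))); last first.
    by move=> x _; rewrite pair_big.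
  by rewrite pair_big.
rewrite {}split3 (eq_bigr (fun x => (\prod_(y < n) w x y) ^ n * (\prod_(z < n) w x z) ^ n *
   \prod_(y < n) \prod_(z < n) w y z)); last first.
  move=> x _; rewrite (eq_bigr (fun y => (w x y) ^ n * (\prod_(z < n) w x z) * \prod_(z < n) w y z)).
    by rewrite !big_split /= prod_nat_const card_ord expn_prod.
  by move=> y _; rewrite !big_split /= prod_nat_const card_ord.
rewrite !big_split /= prod_nat_const card_ord !expn_prod -!expnD.
by congr (_ ^ _); lia.
Qed.

(* Only the values of d above the diagonal are independent, so the sum over A is
   compared with the sum over all functions vanishing on and below it. *)
Lemma upper_weight_sum n r (A : {set {ffun 'I_n * 'I_n -> 'I_r.+1}})
    (W : 'I_n * 'I_n -> 'I_r.+1 -> nat) :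
    (forall d, d \in A -> forall x y, d (x, y) = d (y, x)) ->
    (forall d, d \in A -> forall x, d (x, x) = ord0) ->
  \sum_(d in A) \prod_(p : 'I_n * 'I_n | p.1 < p.2) W p (d p) <=
  \prod_(p : 'I_n * 'I_n | p.1 < p.2) \sum_c W p c.
Proof.
move=> dsym d0.
pose W' (p : 'I_n * 'I_n) (c : 'I_r.+1) : nat := if p.1 < p.2 then W p c else (c == ord0).
pose g (d : {ffun 'I_n * 'I_n -> 'I_r.+1}) : {ffun 'I_n * 'I_n -> 'I_r.+1} :=
  [ffun p : 'I_n * 'I_n => if p.1 < p.2 then d p else ord0].
have ginj : {in A &, injective g}.
  move=> d d' dA dA' /ffunP e; apply/ffunP => -[x y].
  case: (ltngtP x y) => xy.
  - by have := e (x, y); rewrite !ffunE /= xy.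
  - by rewrite dsym // [RHS]dsym //; have := e (y, x); rewrite !ffunE /= xy.
  by move/val_inj: xy => ->; rewrite !d0.
have -> : \sum_(d in A) \prod_(p : 'I_n * 'I_n | p.1 < p.2) W p (d p) =
    \sum_(d in A) \prod_p W' p (g d p).
  apply: eq_bigr => d _; rewrite big_mkcond; apply: eq_bigr => p _.
  by rewrite /W' ffunE; case: (p.1 < p.2).
rewrite -(big_imset (fun h : {ffun 'I_n * 'I_n -> 'I_r.+1} => \prod_p W' p (h p)) ginj) /=.
apply: (@leq_trans (\sum_(h : {ffun 'I_n * 'I_n -> 'I_r.+1}) \prod_p W' p (h p))).
  by rewrite [leqRHS](bigID (mem (g @: A))) leq_addr.
rewrite -(bigA_distr_bigA W') [leqRHS]big_mkcond /=.
apply: leq_prod => p _; rewrite /W'; case: (p.1 < p.2) => //.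
by rewrite (bigD1 ord0) //= big1 // => c /negbTE ->.
Qed.

Lemma sum_weight_mem (K : finType) (C : {set K}) L :
  \sum_(c : K) (if c \in C then L else 1) <= L * #|C| + #|K|.
Proof.
rewrite (bigID (mem C)) /=; apply: leq_add.
  by rewrite (eq_bigr (fun=> L)) ?sum_nat_const 1?mulnC // => c ->.
rewrite (eq_bigr (fun=> 1)) ?sum1_card; last by move=> c /negbTE ->.
exact: max_card.
Qed.

(** Container colours weigh L and all others 1: at most k exceptions cost at most a factor L^k,
    while the total weight factors over the pairs. Exceptional pairs and their colours thus need no
    separate enumeration; their price is the summand [r.+1]. *)
Lemma weighted_count n r (A : {set {ffun 'I_n * 'I_n -> 'I_r.+1}})
    (C : 'I_n -> 'I_n -> {set 'I_r.+1}) (L k : nat) : 0 < L ->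
    (forall d, d \in A -> forall x y, d (x, y) = d (y, x)) ->
    (forall d, d \in A -> forall x, d (x, x) = ord0) ->
    (forall d, d \in A ->
      #|[set p : 'I_n * 'I_n | (p.1 < p.2) && (d p \notin C p.1 p.2)]| <= k) ->
  #|A| * L ^ #|[set p : 'I_n * 'I_n | p.1 < p.2]|
    <= L ^ k * \prod_(p : 'I_n * 'I_n | p.1 < p.2) (L * #|C p.1 p.2| + r.+1).
Proof.
move=> L0 dsym d0 dexc.
pose W (p : 'I_n * 'I_n) (c : 'I_r.+1) : nat := if c \in C p.1 p.2 then L else 1.
have lower d : d \in A -> L ^ #|[set p : 'I_n * 'I_n | p.1 < p.2]| <=
    L ^ k * \prod_(p : 'I_n * 'I_n | p.1 < p.2) W p (d p).
  move=> dA; have -> : \prod_(p : 'I_n * 'I_n | p.1 < p.2) W p (d p) =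
      L ^ #|[set p : 'I_n * 'I_n | (p.1 < p.2) && (d p \in C p.1 p.2)]|.
    rewrite -prod_nat_const [LHS]big_mkcond [RHS]big_mkcond; apply: eq_bigr => p _.
    by rewrite inE /W; case: (p.1 < p.2).
  rewrite -expnD; apply: leq_pexp2l => //.
  apply: leq_trans (leq_add (dexc d dA) (leqnn _)).
  rewrite -cardsUI; apply: leq_trans (leq_addr _ _).
  apply: subset_leq_card; apply/subsetP => p; rewrite !inE => ->.
  by rewrite orNb.
apply: (@leq_trans (\sum_(d in A) L ^ k * \prod_(p : 'I_n * 'I_n | p.1 < p.2) W p (d p))).
  by rewrite -sum_nat_const; apply: leq_sum => d; apply: lower.
rewrite -big_distrr /= leq_mul2l; apply/orP; right.
apply: leq_trans (upper_weight_sum W dsym d0) _.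
apply: leq_prod => p _; apply: leq_trans (sum_weight_mem _ _) _.
by rewrite card_ord.
Qed.

Section TripleBound.
Variables (n r a L t0 t1 h0 h1 : nat) (Phi : {set {ffun 'I_n -> 'I_r.+1}}).
Variables (S : 'I_n -> {set 'I_n * 'I_r.+1}) (Z : {set 'I_n}).
Hypotheses (th0 : t0 + 2 = 2 * h0) (th1 : t1 + 2 = 2 * h1).
Hypotheses (h0_gt0 : 0 < h0) (h1_gt0 : 0 < h1) (rt0 : r <= t0).
Hypothesis hL : 4 * r.+1 ^ 3 <= L.

Local Notation cnt := (cont Phi a S Z t1).
Local Notation big := ((L * r.+1 + r.+1) ^ 3).

(** Degenerate and bad triples receive the trivial bound; every other triple obeys [prod_tri_sets],
    with the lower cap when it lies inside [Z]. *)
Lemma cont_prod_triples :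
  (\prod_(p : 'I_n * 'I_n | p.1 < p.2) (L * #|cnt p.1 p.2| + r.+1)) ^ (6 * n) <=
  ((L * h0 + r.+1) ^ 3) ^ (n ^ 3 - #|Z| ^ 3) * ((L * h1 + r.+1) ^ 3) ^ (#|Z| ^ 3) *
  big ^ (3 * n ^ 2 + #|[set p : 'I_n * ('I_n * 'I_n) |
                       bad_triple Phi a S Z t1 p.1 p.2.1 p.2.2]|).
Proof.
pose w x y := if x == y then 1 else L * #|cnt x y| + r.+1.
pose inZ := [set p : 'I_n * ('I_n * 'I_n) | [&& p.1 \in Z, p.2.1 \in Z & p.2.2 \in Z]].
pose degen (p : 'I_n * ('I_n * 'I_n)) := [|| p.1 == p.2.1, p.1 == p.2.2 | p.2.1 == p.2.2].
pose badp (p : 'I_n * ('I_n * 'I_n)) := bad_triple Phi a S Z t1 p.1 p.2.1 p.2.2.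
have cardZ : #|inZ| = #|Z| ^ 3.
  rewrite !expnS expn0 muln1 -!cardsX; apply: eq_card => p; by rewrite !inE.
have cardD : #|[set p | degen p]| <= 3 * n ^ 2.
  pose f (q : 'I_3 * ('I_n * 'I_n)) : 'I_n * ('I_n * 'I_n) :=
    if q.1 == 0 :> nat then (q.2.1, (q.2.1, q.2.2)) else
    if q.1 == 1 :> nat then (q.2.1, (q.2.2, q.2.1)) else (q.2.1, (q.2.2, q.2.2)).
  apply: (@leq_trans #|f @: [set: 'I_3 * ('I_n * 'I_n)]|); last first.
    by apply: leq_trans (leq_imset_card _ _) _; rewrite cardsT !card_prod !card_ord mulnn.
  apply: subset_leq_card; apply/subsetP => -[x [y z]]; rewrite inE /degen /= => /or3P [] /eqP e.
  - by apply/imsetP; exists (inord 0, (x, z)); rewrite ?inE // /f /= inordK // e.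
  - by apply/imsetP; exists (inord 1, (x, y)); rewrite ?inE // /f /= inordK // e.
  - by apply/imsetP; exists (inord 2, (x, y)); rewrite ?inE // /f /= inordK // e.
have -> : (\prod_(p : 'I_n * 'I_n | p.1 < p.2) (L * #|cnt p.1 p.2| + r.+1)) ^ (6 * n) =
    \prod_(p : 'I_n * ('I_n * 'I_n)) (w p.1 p.2.1 * w p.1 p.2.2 * w p.2.1 p.2.2).
  rewrite triples_prod (upper_pairs_prod (w := fun x y => L * #|cnt x y| + r.+1)).
    by rewrite -expnM mulnA.
  by move=> x y; rewrite contC.
pose base p := if p \in inZ then (L * h1 + r.+1) ^ 3 else (L * h0 + r.+1) ^ 3.
have base_gt0 p : 0 < base p.
  by rewrite /base; case: ifP => _; rewrite expn_gt0 addnS.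
have caseA p : w p.1 p.2.1 * w p.1 p.2.2 * w p.2.1 p.2.2 <=
    base p * big ^ (degen p + badp p).
  have wle x y : w x y <= L * r.+1 + r.+1.
    rewrite /w; case: eqP => _; first by rewrite addnS.
    by rewrite leq_add2r leq_mul2l -[X in _ <= X]card_ord max_card orbT.
  have [dp|/norP [d1 /norP [d2 d3]]] := boolP (degen p).
    apply: (@leq_trans big).
      by rewrite !expnS expn0 muln1 -mulnA !leq_mul.
    rewrite expnD mulnCA; apply: leq_pmulr.
    by rewrite muln_gt0 base_gt0 expn_gt0 expn_gt0 addnS.
  have [bp|bp] := boolP (badp p).
    apply: (@leq_trans big).
      by rewrite !expnS expn0 muln1 -mulnA !leq_mul.
    by rewrite add0n expn1 leq_pmull.
  rewrite add0n expn0 muln1 /w (negbTE d1) (negbTE d2) (negbTE d3).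
  have nb : forall b c k : 'I_r.+1, b \in cnt p.1 p.2.1 -> c \in cnt p.1 p.2.2 ->
      k \in cnt p.2.1 p.2.2 -> tri b c k.
    move=> b c k hb hc hk; apply: contraR bp => ht.
    apply/exists_inP; exists b => //; apply/exists_inP; exists c => //.
    by apply/exists_inP; exists k.
  rewrite /base; case: ifP => pZ.
    move: pZ; rewrite inE => /and3P [Z1 Z2 Z3].
    apply: (prod_tri_sets th1) => // b; rewrite in_cont => /and4P [_ _ _];
      by rewrite ?Z1 ?Z2 ?Z3.
  by apply: (prod_tri_sets th0) => // b _; apply: leq_trans rt0; rewrite -ltnS.
apply: leq_trans (leq_prod (fun p _ => caseA p)) _.
rewrite big_split /= leq_mul //.
  rewrite /base (bigID (mem inZ)) /= mulnC.
  rewrite (eq_bigr (fun=> (L * h0 + r.+1) ^ 3)) /=; last by move=> p /negbTE ->.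
  rewrite [X in _ * X](eq_bigr (fun=> (L * h1 + r.+1) ^ 3)) /=; last by move=> p ->.
  rewrite [X in X * _](eq_bigl (fun p => p \in ~: inZ)); last by move=> p; rewrite in_setC.
  rewrite !prod_nat_const cardZ leq_mul // leq_pexp2l ?expn_gt0 ?addnS //.
  have := cardsC inZ; rewrite cardZ !card_prod !card_ord !expnS expn0 !muln1; lia.
rewrite -expn_sum; apply: leq_pexp2l; first by rewrite expn_gt0 addnS.
rewrite big_split /= leq_add //.
  by apply: leq_trans cardD; rewrite -sum1_card [leqRHS]big_mkcond /= leq_sum // => p _; rewrite inE; case: (degen p).
by rewrite -sum1_card [leqRHS]big_mkcond /= leq_sum // => p _; rewrite inE /badp; case: bad_triple.
Qed.
End TripleBound.

(* Pseudometrics: d may vanish off the diagonal, so these over-count the metrics. *)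
Definition pmet n r : {set {ffun 'I_n * 'I_n -> 'I_r.+1}} :=
  [set d : {ffun 'I_n * 'I_n -> 'I_r.+1} | [&& [forall x, d (x, x) == ord0],
     [forall x, forall y, d (x, y) == d (y, x)] &
     [forall x, forall y, forall z, tri (d (x, y)) (d (x, z)) (d (y, z))]]].

Lemma pmetP n r (d : {ffun 'I_n * 'I_n -> 'I_r.+1}) :
  reflect [/\ forall x, d (x, x) = ord0, forall x y, d (x, y) = d (y, x) &
              forall x y z, tri (d (x, y)) (d (x, z)) (d (y, z))]
          (d \in pmet n r).
Proof.
rewrite inE; apply: (iffP and3P) => -[h1 h2 h3]; split.
- by move=> x; apply/eqP; apply: (forallP h1).
- by move=> x y; apply/eqP; apply: (forallP (forallP h2 x)).
- by move=> x y z; apply: (forallP (forallP (forallP h3 x) y)).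
- by apply/forallP => x; rewrite h1.
- by apply/forallP => x; apply/forallP => y; rewrite h2.
- by do 3![apply/forallP => ?]; apply: h3.
Qed.

Definition pmet_on n r (Z : {set 'I_n}) (t : nat) :=
  [set d in pmet n r | [forall x in Z, forall y in Z, d (x, y) <= t]].

(* With b = 2 e a (r + 1), profiles clashing at most n^2 / (2 e b) times leave at most
   n / (2 e) vertices of degree above n / b, see core_fingerprint. *)
Definition fp_profiles (r a e : nat) := 2 * e * (2 * e * (a * r.+1)) * r.+1.

Definition exceptions n r (d : {ffun 'I_n * 'I_n -> 'I_r.+1})
    (C : 'I_n -> 'I_n -> {set 'I_r.+1}) :=
  [set p : 'I_n * 'I_n | (p.1 < p.2) && (d p \notin C p.1 p.2)].

(** An edge whose colour leaves the container is rejected by the core of one of its ends, and each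
    core rejects at most n / e vertices. *)
Lemma fingerprint_exists n r a e t (Z : {set 'I_n}) d :
  0 < n -> 0 < a -> d \in pmet_on r Z t ->
  exists (Phi : {set {ffun 'I_n -> 'I_r.+1}}) (S : {ffun 'I_n -> {set 'I_n * 'I_r.+1}}),
    [/\ #|Phi| <= fp_profiles r a e, forall x, #|S x| <= a * r.+1 &
        e * #|exceptions d (cont Phi a S Z t)| <= 2 * n ^ 2].
Proof.
move=> n0 a0; rewrite inE => /andP [/pmetP [dd ds dt] dZ].
have [Phi [subPhi cardPhi cl]] := profiles_fingerprint d (2 * e * (2 * e * (a * r.+1))) n0.
exists Phi.
pose good x (S : {set 'I_n * 'I_r.+1}) :=
  (#|S| <= a * r.+1) && (e * #|graph_of (profile d x) :\: core Phi a S| <= n).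
have ex x : exists S, good x S.
  by have [S [h1 h2]] := core_fingerprint n0 a0 (cl x); exists S; rewrite /good h1 h2.
pose S := [ffun x => xchoose (ex x)].
have hS x : good x (S x) by rewrite ffunE; apply: (xchooseP (ex x)).
exists S; split=> //; first by move=> x; have /andP [] := hS x.
pose E := [set p : 'I_n * 'I_n | (p.2, d (p.1, p.2)) \notin core Phi a (S p.1)].
have cardE : e * #|E| <= n ^ 2.
  rewrite (card_pairs (fun x y => (y, d (x, y)) \notin core Phi a (S x))) big_distrr /=.
  apply: (@leq_trans (\sum_(x < n) n)); last by rewrite sum_nat_const card_ord mulnn.
  apply: leq_sum => x _; have /andP [_] := hS x; apply: leq_trans.
  rewrite leq_mul2l; apply/orP; right.
  pose f (y : 'I_n) := (y, d (x, y)).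
  have finj : injective f by move=> y y' [].
  rewrite -(card_imset _ finj); apply: subset_leq_card; apply/subsetP => u /imsetP [y].
  by rewrite inE => h ->; rewrite in_setD h inE /= ffunE eqxx.
pose sw (p : 'I_n * 'I_n) := (p.2, p.1).
have sub : exceptions d (cont Phi a S Z t) \subset E :|: sw @: E.
  apply/subsetP => -[x y]; rewrite in_set in_cont /= => /andP [_].
  have -> : d (x, y) \in cand Phi x y.
    rewrite inE; apply/forall_inP => phi /(subsetP subPhi) /imsetP [v _ ->].
    by rewrite !ffunE tri_swapr tri_swapl tri_swapr tri_swapl; apply: dt.
  have -> : (x \in Z) && (y \in Z) ==> (d (x, y) <= t).
    apply/implyP => /andP [xZ yZ].
    by have /forall_inP /(_ x xZ) /forall_inP /(_ y yZ) := dZ.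
  rewrite andbT /= negb_and in_setU => /orP [h|h]; first by rewrite inE h.
  apply/orP; right; apply/imsetP; exists (y, x) => //; by rewrite inE /= ds.
have h : #|exceptions d (cont Phi a S Z t)| <= #|E| + #|E|.
  apply: leq_trans (subset_leq_card sub) _; apply: leq_trans (leq_card_setU _ _) _.
  by rewrite leq_add2l leq_imset_card.
apply: leq_trans (leq_mul (leqnn e) h) _.
by rewrite addnn -mul2n mulnCA leq_mul2l cardE orbT.
Qed.

Lemma sum_exp_bound (I : finType) (A : {set I}) (F : I -> nat) k X : 0 < k ->
  (forall i, i \in A -> F i ^ k <= X) -> (\sum_(i in A) F i) ^ k <= #|A| ^ k * X.
Proof.
move=> k0 h; have hm : (\max_(i in A) F i) ^ k <= X.
  elim/big_ind: _ => //; first by rewrite exp0n.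
  by move=> x y hx hy; case: (leqP x y).
apply: (@leq_trans ((#|A| * \max_(i in A) F i) ^ k)); last by rewrite expnMn leq_mul2l hm orbT.
rewrite leq_exp2r // -sum_nat_const; apply: leq_sum => i iA.
exact: (@leq_bigmax_cond _ (mem A) F i iA).
Qed.

Section FixedSet.
Variables (n r a e L t0 t1 h0 h1 : nat) (Z : {set 'I_n}).
Hypotheses (th0 : t0 + 2 = 2 * h0) (th1 : t1 + 2 = 2 * h1).
Hypotheses (h0_gt0 : 0 < h0) (h1_gt0 : 0 < h1) (rt0 : r <= t0).
Hypothesis hL : 4 * r.+1 ^ 3 <= L.
Hypotheses (n_gt0 : 0 < n) (a_gt0 : 0 < a) (e_gt0 : 0 < e).

(** For fixed a and e there are only exp(O(n log n)) fingerprints. The power [6 * n] lets the triple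
    bound be used without extracting roots. *)
Lemma card_pmet_on :
  (#|pmet_on r Z t1| * L ^ #|[set p : 'I_n * 'I_n | p.1 < p.2]|) ^ (6 * n) <=
  ((r.+1 ^ n).+1 ^ fp_profiles r a e * ((n * r.+1).+1 ^ (a * r.+1)) ^ n) ^ (6 * n) *
  ((L ^ (2 * n ^ 2 %/ e)) ^ (6 * n) *
   (((L * h0 + r.+1) ^ 3) ^ (n ^ 3 - #|Z| ^ 3) * ((L * h1 + r.+1) ^ 3) ^ (#|Z| ^ 3) *
    ((L * r.+1 + r.+1) ^ 3) ^ (3 * n ^ 2 + n ^ 3 * r.+1 %/ a))).
Proof.
pose FP := setX [set Phi : {set {ffun 'I_n -> 'I_r.+1}} | #|Phi| <= fp_profiles r a e]
  [set S : {ffun 'I_n -> {set 'I_n * 'I_r.+1}} | [forall x, #|S x| <= a * r.+1]].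
pose A (q : {set {ffun 'I_n -> 'I_r.+1}} * {ffun 'I_n -> {set 'I_n * 'I_r.+1}}) :=
  [set d in pmet_on r Z t1 | e * #|exceptions d (cont q.1 a q.2 Z t1)| <= 2 * n ^ 2].
have L0 : 0 < L by apply: leq_trans hL; rewrite muln_gt0 expn_gt0.
have cover : #|pmet_on r Z t1| <= \sum_(q in FP) #|A q|.
  apply: (@leq_trans #|\bigcup_(q in FP) A q|).
    apply: subset_leq_card; apply/subsetP => d dZ.
    have [Phi [S [h1' h2 h3]]] := fingerprint_exists e n_gt0 a_gt0 dZ.
    apply/bigcupP; exists (Phi, S); last by rewrite inE dZ.
    by rewrite !inE h1' /=; apply/forallP.
  elim/big_rec2: _ => [|q s B _ IH]; first by rewrite cards0.
  by apply: leq_trans (leq_card_setU _ _) _; rewrite leq_add2l.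
have cardFP : #|FP| <= (r.+1 ^ n).+1 ^ fp_profiles r a e * ((n * r.+1).+1 ^ (a * r.+1)) ^ n.
  rewrite cardsX; apply: leq_mul.
    by apply: leq_trans (card_small_sets _ _) _; rewrite card_ffun !card_ord.
  pose T := [set S : {set 'I_n * 'I_r.+1} | #|S| <= a * r.+1].
  apply: (@leq_trans #|[set S : {ffun 'I_n -> {set 'I_n * 'I_r.+1}} | S \in ffun_on (mem T)]|).
    apply: subset_leq_card; apply/subsetP => S; rewrite !inE => /forallP h.
    by apply/ffun_onP => x; rewrite inE; apply: h.
  rewrite cardsE card_ffun_on card_ord leq_exp2r //.
  by apply: leq_trans (card_small_sets _ _) _; rewrite card_prod !card_ord.
have k0 : 0 < 6 * n by rewrite muln_gt0.
apply: (@leq_trans ((\sum_(q in FP) #|A q| * L ^ #|[set p : 'I_n * 'I_n | p.1 < p.2]|) ^ (6 * n))).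
  by rewrite leq_exp2r // -big_distrl /= leq_mul2r cover orbT.
set X := (X in _ <= _ * X).
apply: (@leq_trans (#|FP| ^ (6 * n) * X)); last by rewrite leq_mul2r leq_exp2r // cardFP orbT.
apply: sum_exp_bound => // -[Phi S] _.
apply: (@leq_trans ((L ^ (2 * n ^ 2 %/ e) * \prod_(p : 'I_n * 'I_n | p.1 < p.2)
    (L * #|cont Phi a S Z t1 p.1 p.2| + r.+1)) ^ (6 * n))).
  rewrite leq_exp2r //; apply: weighted_count => // d.
  - by rewrite 2!inE => /andP [/andP [/pmetP [_ ds _] _] _].
  - by rewrite 2!inE => /andP [/andP [/pmetP [dd _ _] _] _].
  by rewrite inE => /andP [_]; rewrite leq_divRL // mulnC.
rewrite expnMn leq_mul2l; apply/orP; right.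
apply: leq_trans (cont_prod_triples a Phi S Z th0 th1 h0_gt0 h1_gt0 rt0 hL) _.
rewrite leq_mul2l; apply/orP; right; apply: leq_pexp2l; first by rewrite expn_gt0 addnS.
by rewrite leq_add2l leq_divRL // mulnC card_bad_triples.
Qed.
End FixedSet.

(** * Short edges: crowded vertices and removal of two points *)

Definition small_nbrs n r m (d : {ffun 'I_n * 'I_n -> 'I_r.+1}) (x : 'I_n) : {set 'I_n} :=
  [set y | d (x, y) < m].

Definition crowded n r m q (d : {ffun 'I_n * 'I_n -> 'I_r.+1}) : bool :=
  [exists x, n <= q * #|small_nbrs m d x|].

Definition has_small_edge n r m (d : {ffun 'I_n * 'I_n -> 'I_r.+1}) : bool :=
  [exists x, exists y, (x != y) && (d (x, y) < m)].

Definition pmet_crowded n r m q := [set d in pmet n r | crowded m q d].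

Definition pmet_sparse n r m q :=
  [set d in pmet n r | ~~ crowded m q d && has_small_edge m d].

Lemma card_ge_colours r m : #|[set c : 'I_r.+1 | m <= c]| <= r.+1 - m.
Proof.
pose f (i : 'I_(r.+1 - m)) : 'I_r.+1 := inord (m + i).
apply: (@leq_trans #|f @: [set: 'I_(r.+1 - m)]|); last first.
  by apply: leq_trans (leq_imset_card _ _) _; rewrite cardsT card_ord.
apply: subset_leq_card; apply/subsetP => c; rewrite inE => mc.
have hc : c - m < r.+1 - m by have := ltn_ord c; lia.
apply/imsetP; exists (Ordinal hc) => //; apply: val_inj.
by rewrite /f /= subnKC // inord_val.
Qed.

(** The main term: for r = 2m this is (m + 1)^C(n,2), the summand 1 of the normalised recursion. *)
Lemma card_pmet_no_small_edge n r m :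
  #|[set d in pmet n r | ~~ has_small_edge m d]|
    <= (r.+1 - m) ^ #|[set p : 'I_n * 'I_n | p.1 < p.2]|.
Proof.
set A := [set d in _ | _].
pose W (p : 'I_n * 'I_n) (c : 'I_r.+1) : nat := m <= c.
have hsum : #|A| <= \sum_(d in A) \prod_(p : 'I_n * 'I_n | p.1 < p.2) W p (d p).
  rewrite -sum1_card; apply: leq_sum => d; rewrite inE => /andP [_ hd].
  rewrite big1 // => -[x y] /= xy; rewrite /W leqNgt.
  case: ltnP => // h; case/negP: hd; apply/existsP; exists x; apply/existsP; exists y.
  by rewrite h andbT; apply: contraTneq xy => ->; rewrite ltnn.
apply: leq_trans hsum _; apply: leq_trans (upper_weight_sum W _ _) _.
- by move=> d; rewrite inE => /andP [/pmetP []].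
- by move=> d; rewrite inE => /andP [/pmetP []].
rewrite -prod_nat_const [leqRHS](eq_bigl (fun p : 'I_n * 'I_n => p.1 < p.2)); last first.
  by move=> p; rewrite inE.
apply: leq_prod => p _; apply: leq_trans (card_ge_colours r m).
by rewrite -sum1_card [leqRHS]big_mkcond leq_sum // => c _; rewrite inE /W; case: (m <= c).
Qed.

Section Words.
Variables (T : finType) (G : {set T}).

Definition bad_letters n (w : {ffun 'I_n -> T}) := [set i | w i \notin G].

(** The weighting of [weighted_count], for words: letters of [G] weigh L, the others 1. *)
Lemma card_sparse_words n k (L : nat) : 0 < L ->
  #|[set w : {ffun 'I_n -> T} | #|bad_letters w| <= k]| * L ^ n
    <= L ^ k * (L * #|G| + #|T|) ^ n.
Proof.
move=> L0.
pose W (i : 'I_n) (c : T) := if c \in G then L else 1.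
have lower (w : {ffun 'I_n -> T}) : #|bad_letters w| <= k -> L ^ n <= L ^ k * \prod_i W i (w i).
  move=> hw; have -> : \prod_i W i (w i) = L ^ #|~: bad_letters w|.
    rewrite -prod_nat_const [RHS]big_mkcond; apply: eq_bigr => i _.
    by rewrite !inE negbK.
  rewrite -expnD; apply: leq_pexp2l => //.
  by rewrite -{1}[n]card_ord -(cardsC (bad_letters w)) leq_add2r.
apply: (@leq_trans (\sum_(w : {ffun 'I_n -> T} | #|bad_letters w| <= k) L ^ k * \prod_i W i (w i))).
  rewrite -sum_nat_const (eq_bigl (fun w : {ffun 'I_n -> T} => #|bad_letters w| <= k)).
    exact: leq_sum.
  by move=> w; rewrite inE.
apply: (@leq_trans (\sum_(w : {ffun 'I_n -> T}) L ^ k * \prod_i W i (w i))).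
  by rewrite [leqRHS](bigID (fun w => #|bad_letters w| <= k)) leq_addr.
rewrite -big_distrr leq_mul2l; apply/orP; right.
rewrite -(bigA_distr_bigA W) -[X in _ ^ X](card_ord n) -prod_nat_const.
by apply: leq_prod => i _; apply: sum_weight_mem.
Qed.
End Words.

Definition wide_letters m : {set 'I_(2 * m).+1 * 'I_(2 * m).+1} :=
  setX [set c : 'I_(2 * m).+1 | m <= c] [set c : 'I_(2 * m).+1 | m <= c] :\ (inord m, inord (2 * m)).

Lemma card_wide_letters m : #|wide_letters m| <= m.+1 ^ 2 - 1.
Proof.
have mem : (inord m, inord (2 * m)) \in
    setX [set c : 'I_(2 * m).+1 | m <= c] [set c : 'I_(2 * m).+1 | m <= c].
  by rewrite !inE !inordK //; lia.
have := cardsD1 (inord m, inord (2 * m))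
  (setX [set c : 'I_(2 * m).+1 | m <= c] [set c : 'I_(2 * m).+1 | m <= c]).
rewrite mem -/(wide_letters m) cardsX => e.
have h := card_ge_colours (2 * m) m.
have h2 : #|[set c : 'I_(2 * m).+1 | m <= c]| * #|[set c : 'I_(2 * m).+1 | m <= c]| <= m.+1 ^ 2.
  by rewrite -mulnn leq_mul //; apply: leq_trans h _; lia.
rewrite e in h2; rewrite -(leq_add2l 1) subnKC ?expn_gt0 //; exact: h2.
Qed.

(* A short edge xy forbids the letter (m, 2m), since d(y,z) <= d(x,z) + d(x,y) < 2m
   whenever d(x,z) = m. *)
Lemma card_pmet_sparse n m q :
  #|pmet_sparse n.+2 (2 * m) m q| <=
  n.+2 * n.+1 * ((2 * m).+1 * #|pmet n (2 * m)| *
    #|[set w : {ffun 'I_n -> 'I_(2 * m).+1 * 'I_(2 * m).+1} |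
        q * #|bad_letters (wide_letters m) w| <= 2 * n.+2]|).
Proof.
set r := 2 * m; set Words := [set w | _].
pose P (q' : 'I_n.+2 * 'I_n.+1) := [set d in pmet_sparse n.+2 r m q | d (q'.1, lift q'.1 q'.2) < m].
apply: (@leq_trans (\sum_(q' : 'I_n.+2 * 'I_n.+1) #|P q'|)).
  apply: (@leq_trans #|\bigcup_(q' : 'I_n.+2 * 'I_n.+1) P q'|).
    apply: subset_leq_card; apply/subsetP => d hd.
    have := hd; rewrite inE => /and3P [_ _ /existsP [x /existsP [y /andP [xy dxy]]]].
    have [y' ey _] := unlift_some xy.
    by apply/bigcupP; exists (x, y') => //; rewrite inE hd /= -ey.
  elim/big_rec2: _ => [|q' s B _ IH]; first by rewrite cards0.
  by apply: leq_trans (leq_card_setU _ _) _; rewrite leq_add2l.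
apply: (@leq_trans (\sum_(q' : 'I_n.+2 * 'I_n.+1) r.+1 * #|pmet n r| * #|Words|)); last first.
  by rewrite sum_nat_const card_prod !card_ord.
apply: leq_sum => -[x y'] _; rewrite /P /=.
pose y := lift x y'; pose h (i : 'I_n) := lift x (lift y' i).
(* By symmetry and the zero diagonal, d is recovered from d(x, y), its restriction to the other n
   points, and one letter (d(x, z), d(y, z)) for each such point z. *)
pose enc (d : {ffun 'I_n.+2 * 'I_n.+2 -> 'I_r.+1}) :=
  (d (x, y), [ffun p : 'I_n * 'I_n => d (h p.1, h p.2)],
   [ffun i : 'I_n => (d (x, h i), d (y, h i))]).
pose Tgt := setX (setX [set: 'I_r.+1] (pmet n r)) Words.
have <- : #|Tgt| = r.+1 * #|pmet n r| * #|Words| by rewrite !cardsX cardsT card_ord.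
set A := [set d in _ | _].
have split_pt (u : 'I_n.+2) : [\/ u = x, u = y | exists i, u = h i].
  case: (eqVneq x u) => [->|xu]; first by constructor 1.
  have [u' -> _] := unlift_some xu.
  case: (eqVneq y' u') => [<-|yu]; first by constructor 2.
  by have [i -> _] := unlift_some yu; constructor 3; exists i.
have encinj : {in A &, injective enc}.
  have Apmet d : d \in A -> d \in pmet n.+2 r.
    by rewrite inE => /andP [+ _]; rewrite inE => /andP [].
  move=> d d' /Apmet /pmetP [dd ds _] /Apmet /pmetP [dd' ds' _].
  case=> exy /ffunP ehh /ffunP exh.
  have e1 i : d (x, h i) = d' (x, h i) by have := exh i; rewrite !ffunE => -[].
  have e2 i : d (y, h i) = d' (y, h i) by have := exh i; rewrite !ffunE => -[].
  have e3 i j : d (h i, h j) = d' (h i, h j) by have := ehh (i, j); rewrite !ffunE.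
  apply/ffunP => -[u v].
  case: (split_pt u) => [->|->|[i ->]]; case: (split_pt v) => [->|->|[j ->]];
    by rewrite ?dd ?dd' // ds ds'.
rewrite -(card_in_imset encinj); apply: subset_leq_card; apply/subsetP => _ /imsetP [d dA ->].
move: dA; rewrite inE => /andP [hd dxy].
move: hd; rewrite inE => /and3P [/pmetP [dd ds dt] ncr _].
rewrite !in_setX inE /=; apply/andP; split.
  apply/pmetP; split; first by move=> i; rewrite ffunE dd.
    by move=> i j; rewrite !ffunE ds.
  by move=> i j k; rewrite !ffunE.
rewrite inE.
have hinj : injective h by move=> i j /lift_inj /lift_inj.
have sm u : q * #|small_nbrs m d u| <= n.+2.
  by apply: ltnW; rewrite ltnNge; apply: contra ncr => hu; apply/existsP; exists u.
(* The letter (m, 2m) never occurs, so a bad letter has a coordinate below m; without crowding, each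
   of x and y has fewer than (n + 2) / q such points. *)
apply: (@leq_trans (q * (#|small_nbrs m d x| + #|small_nbrs m d y|))); last first.
  by rewrite mulnDr mul2n -addnn leq_add.
rewrite leq_mul2l; apply/orP; right.
rewrite -(card_imset _ hinj); apply: leq_trans (leq_card_setU _ _).
apply: subset_leq_card; apply/subsetP => _ /imsetP [i hi ->].
move: hi; rewrite inE ffunE /wide_letters in_setD1 in_setX negb_and negbK in_setU.
case/orP => [/eqP [e1 e2]|]; last by rewrite !inE negb_and -!ltnNge.
have := dt x y (h i); rewrite e1 e2 /tri !inordK; last by lia.
  by move=> /and3P [_ _]; move: dxy => /=; rewrite -/y; lia.
by lia.
Qed.

(** * Passage to logarithms and choice of the constants *)

Import Order.TTheory GRing.Theory Num.Theory.

Lemma card_upper_pairs n : #|[set p : 'I_n * 'I_n | p.1 < p.2]| = 'C(n, 2).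
Proof.
rewrite (card_pairs (fun x y : 'I_n => x < y)) -bin2_sum big_mkord.
rewrite (reindex_inj rev_ord_inj) /=; apply: eq_bigr => i _.
have hf : injective (fun j : 'I_i => rev_ord (widen_ord (ltnW (ltn_ord i)) j)).
  by move=> j k /rev_ord_inj /(congr1 val) /= jk; apply: val_inj.
rewrite -[RHS]card_ord -(card_imset _ hf); apply: eq_card => y.
rewrite inE; apply/idP/imsetP => [h|[j _ ->] /=]; last by have := ltn_ord j; have := ltn_ord i; lia.
have hj : n - y.+1 < i by move: h (ltn_ord i) (ltn_ord y) => /=; lia.
by exists (Ordinal hj) => //; apply: val_inj => /=; have := ltn_ord y; lia.
Qed.


Local Open Scope ring_scope.

Definition lnat (R : realType) (k : nat) : R := ln k%:R.

Lemma lnatM (R : realType) (a b : nat) : (0 < a)%N -> (0 < b)%N ->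
  lnat R (a * b) = lnat R a + lnat R b.
Proof. by move=> a0 b0; rewrite /lnat natrM lnM // posrE ltr0n. Qed.

Lemma lnatX (R : realType) (a k : nat) : (0 < a)%N -> lnat R (a ^ k) = k%:R * lnat R a.
Proof. by move=> a0; rewrite /lnat natrX lnXn ?ltr0n // mulr_natl. Qed.

Lemma ler_lnat (R : realType) (a b : nat) : (0 < a)%N -> (a <= b)%N -> lnat R a <= lnat R b.
Proof. by move=> a0 ab; rewrite /lnat ler_ln ?posrE ?ltr0n ?ler_nat // (leq_trans a0). Qed.

Lemma lnat_le (R : realType) (a b : nat) : (0 < a)%N -> (0 < b)%N -> lnat R a <= lnat R b -> (a <= b)%N.
Proof. by move=> a0 b0; rewrite /lnat ler_ln ?posrE ?ltr0n ?ler_nat. Qed.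

Lemma lnat_ge0 (R : realType) (a : nat) : (0 < a)%N -> 0 <= lnat R a.
Proof. by move=> a0; rewrite /lnat ln_ge0 // ler1n. Qed.

(** This is ln x < x at x = eta n. A small eta turns the n log n of the fingerprints into a small
    multiple of n^2 plus a linear term. *)
Lemma lnat_le_linear (R : realType) (eta : R) (n : nat) : 0 < eta -> (0 < n)%N ->
  lnat R n <= eta * n%:R - ln eta.
Proof.
move=> e0 n0; have h : 0 < eta * n%:R by rewrite mulr_gt0 ?ltr0n.
have -> : lnat R n = ln (eta * n%:R) - ln eta.
  by rewrite lnM ?posrE ?ltr0n // addrC addKr.
by rewrite lerD2r; apply: ltW; apply: ln_sublinear.
Qed.

Lemma lnat_card_pmet_on (R : realType) (n r a e L t0 t1 h0 h1 : nat) (Z : {set 'I_n}) :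
  (t0 + 2 = 2 * h0)%N -> (t1 + 2 = 2 * h1)%N -> (0 < h0)%N -> (0 < h1)%N ->
  (r <= t0)%N -> (4 * r.+1 ^ 3 <= L)%N -> (0 < n)%N -> (0 < a)%N -> (0 < e)%N ->
  (0 < #|pmet_on r Z t1|)%N ->
  6 * n%:R * (lnat R #|pmet_on r Z t1| + 'C(n, 2)%:R * lnat R L) <=
  6 * n%:R * ((fp_profiles r a e)%:R * lnat R (r.+1 ^ n).+1 +
              n%:R * ((a * r.+1)%:R * lnat R (n * r.+1).+1)) +
  (6 * n%:R * ((2 * n ^ 2 %/ e)%:R * lnat R L) +
   ((n ^ 3 - #|Z| ^ 3)%:R * (3 * lnat R (L * h0 + r.+1)) +
    (#|Z| ^ 3)%:R * (3 * lnat R (L * h1 + r.+1)) +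
    (3 * n ^ 2 + n ^ 3 * r.+1 %/ a)%:R * (3 * lnat R (L * r.+1 + r.+1)))).
Proof.
move=> th0 th1 h0_gt0 h1_gt0 rt0 hL n0 a0 e0 X0.
have L0 : (0 < L)%N by apply: leq_trans hL; rewrite muln_gt0 expn_gt0.
have := card_pmet_on Z th0 th1 h0_gt0 h1_gt0 rt0 hL n0 a0 e0.
have big0 h : (0 < L * h + r.+1)%N by rewrite addnS.
move/(@ler_lnat R _ _).
rewrite expn_gt0 muln_gt0 X0 expn_gt0 L0 => /(_ isT).
rewrite card_upper_pairs.
rewrite !(lnatX, lnatM) ?(expn_gt0, muln_gt0, X0, L0, big0) //.
by rewrite !natrM.
Qed.

(* With A, B, D the logarithms of the three weights and g <= A - B, the gain
   n^2 g / (2 q^3) on Z beats the errors as soon as n is large. *)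
Lemma log_balance (R : realType) (N P X lL A B D z3 k y E1 g q3 : R) :
  0 < N -> 0 <= lL -> 0 <= D -> 0 < q3 ->
  6 * N * (X + P * lL) <= 6 * N * E1 + (6 * N * (k * lL) +
     ((N ^+ 3 - z3) * (3 * A) + z3 * (3 * B) + (3 * N ^+ 2 + y) * (3 * D))) ->
  P = (N ^+ 2 - N) / 2 -> N ^+ 3 <= q3 * z3 -> 0 <= g -> g <= A - B ->
  X <= E1 + k * lL + N ^+ 2 / 2 * (A - lL) + N / 2 * lL - N ^+ 2 * g / (2 * q3)
       + 3 / 2 * N * D + y * D / (2 * N).
Proof.
move=> N0 lL0 D0 q30 h hP hz g0 hg.
have z30 : 0 <= z3.
  by rewrite -(pmulr_rge0 _ q30); apply: le_trans hz; rewrite exprn_ge0 // ltW.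
have hzg : N ^+ 3 * g / q3 <= z3 * (A - B).
  apply: le_trans (ler_wpM2l z30 hg); rewrite ler_pdivrMr // [leRHS]mulrAC.
  by rewrite ler_wpM2r // mulrC.
rewrite -(ler_pM2l (x := 6 * N)) ?mulr_gt0 //.
have -> : 6 * N * (E1 + k * lL + N ^+ 2 / 2 * (A - lL) + N / 2 * lL -
    N ^+ 2 * g / (2 * q3) + 3 / 2 * N * D + y * D / (2 * N)) =
   6 * N * E1 + 6 * N * (k * lL) + 3 * N ^+ 3 * (A - lL) + 3 * N ^+ 2 * lL
   - 3 * (N ^+ 3 * g / q3) + 9 * N ^+ 2 * D + 3 * y * D.
  by field; rewrite !gt_eqF.
rewrite hP in h; nra.
Qed.

Lemma natr_archi (R : realType) (x : R) : exists k : nat, (0 < k)%N /\ x <= k%:R.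
Proof. by exists (Num.trunc x).+1; split=> //; apply: ltW; apply: truncnS_gt. Qed.

Lemma ler_pdiv_archi (R : realType) (c x k : R) : 0 < c -> 0 < k -> x / c <= k -> x / k <= c.
Proof. by move=> c0 k0; rewrite !ler_pdivrMr // mulrC. Qed.

Lemma natr_bin2 (R : realType) n : ('C(n, 2)%:R : R) = (n%:R ^+ 2 - n%:R) / 2.
Proof.
have : (('C(n, 2) * 2`!)%:R : R) = n%:R ^+ 2 - n%:R.
  rewrite bin_ffact ffactnS ffactn1 natrM.
  by case: n => [|n]; [rewrite expr2 !mul0r subr0 | rewrite -[n.+1]addn1 natrD addn1 /=; ring].
by rewrite (_ : 2`! = 2)%N // natrM => <-; field.
Qed.

Lemma lnat_error_terms (R : realType) (n r J1 J2 : nat) (eta : R) : (0 < n)%N -> 0 < eta ->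
  J1%:R * lnat R (r.+1 ^ n).+1 + n%:R * (J2%:R * lnat R (n * r.+1).+1) <=
  n%:R * (J1%:R * lnat R r.+2) + n%:R * (J2%:R * (eta * n%:R - ln eta + lnat R r.+2)).
Proof.
move=> n0 eta0; apply: lerD.
  rewrite mulrCA ler_wpM2l ?ler0n // -lnatX // ler_lnat //.
  case: n n0 => // n _; elim: n => [|n IH]; first by rewrite !expn1.
  by rewrite expnS [in X in (_ <= X)%N]expnS; apply: leq_trans (leq_mul (leqnn _) IH); lia.
rewrite !ler_wpM2l ?ler0n //.
apply: le_trans (_ : lnat R (n * r.+2) <= _); first by rewrite ler_lnat //; lia.
by rewrite lnatM // lerD2r lnat_le_linear.
Qed.

(** In logarithms, the weights for m + 1 and m colours differ by at least ln ((m + 2) / (m + 1)),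
    whatever l >= s. The gain is thus fixed before L has to be chosen. *)
Lemma weight_ratio (m l s : nat) : (s <= l)%N ->
  (m.+2 * (l * m + s) <= (l * m.+1 + s) * m.+1)%N.
Proof. by move=> sl; lia. Qed.

(** The constants come in the order g, c, L, then a and e, then eta, then N1. The gain is c n^2; the
    errors governed by L, e, a and eta take at most c n^2 / 8 each, and the linear terms in [K] the
    remaining c n^2 / 2. Of the factor 4^n, one 2^n will pay for the choice of [Z]. *)
Lemma card_pmet_on_small (R : realType) (m q : nat) : (1 < m)%N -> (0 < q)%N ->
  exists N0 : nat, forall n : nat, (N0 <= n)%N -> forall Z : {set 'I_n}, (n <= q * #|Z|)%N ->
    (#|pmet_on (2 * m) Z (2 * m - 2)| * 4 ^ n <= m.+1 ^ 'C(n, 2))%N.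
Proof.
move=> m1 q0.
have t0E : (2 * m + 2 = 2 * m.+1)%N by lia.
have t1E : (2 * m - 2 + 2 = 2 * m)%N by lia.
pose r := (2 * m)%N.
pose g := lnat R m.+2 - lnat R m.+1.
have g0 : 0 < g by rewrite subr_gt0 /lnat ltr_ln ?posrE ?ltr0n // ltr_nat.
pose q3 := (q%:R ^+ 3 : R).
have q30 : 0 < q3 by rewrite exprn_gt0 // ltr0n.
pose c := g / (2 * q3).
have c0 : 0 < c by rewrite divr_gt0 // mulr_gt0.
have c40 : 0 < c / 4 by rewrite divr_gt0.
have c80 : 0 < c / 8 by rewrite divr_gt0.
have [L1 [L10 hL1]] := natr_archi (r.+1%:R / (c / 4)).
pose L := (4 * r.+1 ^ 3 + L1)%N.
have hL : (4 * r.+1 ^ 3 <= L)%N by rewrite leq_addr.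
have L0 : (0 < L)%N by rewrite addn_gt0 L10 orbT.
have rL : r.+1%:R / L%:R <= c / 4.
  apply: ler_pdiv_archi; rewrite ?ltr0n //.
  by apply: le_trans hL1 _; rewrite ler_nat leq_addl.
pose lL := lnat R L; pose D := lnat R (L * r.+1 + r.+1).
have lL0 : 0 <= lL by apply: lnat_ge0.
have D0 : 0 <= D by apply: lnat_ge0; rewrite addnS.
have [a [a0 ha]] := natr_archi (r.+1%:R * D / 2 / (c / 8)).
have [e [e0 he]] := natr_archi (2 * lL / (c / 8)).
have {}ha : r.+1%:R * D / 2 / a%:R <= c / 8 by apply: ler_pdiv_archi; rewrite ?ltr0n.
have {}he : 2 * lL / e%:R <= c / 8 by apply: ler_pdiv_archi; rewrite ?ltr0n.
pose J1 := fp_profiles r a e; pose J2 := (a * r.+1)%N.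
have J20 : (0 : R) < J2%:R by rewrite ltr0n muln_gt0 a0.
pose eta := c / 8 / J2%:R.
have eta0 : 0 < eta by rewrite divr_gt0.
(* The last two summands pay for 4^n and for C(n,2) being n / 2 short of n^2 / 2. *)
pose K := J1%:R * lnat R r.+2 + J2%:R * (lnat R r.+2 - ln eta) + lL / 2 + 3 / 2 * D
          + lnat R 4 + lnat R m.+1 / 2.
have [N1 [N10 hN1]] := natr_archi (K / (c / 2)).
exists N1 => n hn Z hZ.
have n0 : (0 < n)%N by apply: leq_trans hn.
have [->|X0] := posnP #|pmet_on r Z (2 * m - 2)|; first by rewrite mul0n.
apply: (@lnat_le R); rewrite ?muln_gt0 ?X0 ?expn_gt0 //.
rewrite lnatM ?expn_gt0 // !lnatX //.
have := lnat_card_pmet_on R t0E t1E (ltn0Sn m) (ltnW m1) (leqnn r) hL n0 a0 e0 X0.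
set A := lnat R (L * m.+1 + r.+1); set B := lnat R (L * m + r.+1).
set E1 := _ + n%:R * _; set k := (2 * n ^ 2 %/ e)%N; set y := (n ^ 3 * r.+1 %/ a)%N.
rewrite natrB; last first.
  by rewrite leq_exp2r // -[X in (_ <= X)%N]card_ord max_card.
rewrite natrD (natrX _ n 3) (natrM _ 3) (natrX _ n 2) -/lL -/D => h.
have hA : A <= lL + lnat R m.+1 + c / 4.
  apply: le_trans (lerD (lexx _) rL); rewrite /A /lL -lnatM //.
  have -> : lnat R (L * m.+1 + r.+1) =
     lnat R (L * m.+1) + ln (1 + r.+1%:R / (L * m.+1)%:R).
    rewrite /lnat -lnM ?posrE ?ltr0n ?muln_gt0 ?L0 // ?addr_gt0 ?divr_gt0 ?ltr0n ?muln_gt0 ?L0 //.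
    by rewrite mulrDr mulr1 mulrCA divff ?mulr1 ?natrD // pnatr_eq0 muln_eq0 negb_or -!lt0n L0.
  rewrite lerD2l; apply: le_trans (le_ln1Dx _) _.
    by rewrite (lt_le_trans (ltrN10 _)) // divr_ge0 ?ler0n.
  rewrite ler_wpM2l ?ler0n // lef_pV2 ?posrE ?ltr0n ?muln_gt0 ?L0 //.
  by rewrite ler_nat leq_pmulr.
have hAB : g <= A - B.
  have rleL : (r.+1 <= L)%N.
    by apply: leq_trans hL; rewrite expnS mulnCA leq_pmulr // muln_gt0 expn_gt0.
  have pos u : (0 < u + r.+1)%N by rewrite addn_gt0 orbT.
  have := @ler_lnat R _ _ _ (weight_ratio m rleL).
  rewrite muln_gt0 pos (lnatM R (ltn0Sn _) (pos _)) (lnatM R (pos _) (ltn0Sn _)) => /(_ isT).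
  by rewrite -/A -/B /g lerBlDr addrAC lerBrDr.
have hz : (n%:R : R) ^+ 3 <= q3 * (#|Z| ^ 3)%:R.
  by rewrite natrX -exprMn -natrM -!natrX ler_nat leq_exp2r.
have N0 : (0 : R) < n%:R by rewrite ltr0n.
have bal := log_balance N0 lL0 D0 q30 h (natr_bin2 R n) hz (ltW g0) hAB.
have hE := lnat_error_terms r J1 J2 n0 eta0.
have hk : k%:R * lL <= n%:R ^+ 2 * (c / 8).
  have : (k%:R : R) <= 2 * n%:R ^+ 2 / e%:R.
    by rewrite ler_pdivlMr ?ltr0n // -natrX -!natrM ler_nat leq_trunc_div.
  move/(ler_wpM2r lL0) => /le_trans; apply.
  rewrite (_ : _ * lL = n%:R ^+ 2 * (2 * lL / e%:R)); last by ring.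
  by rewrite ler_wpM2l ?exprn_ge0 ?ler0n.
have hy : y%:R * D / (2 * n%:R) <= n%:R ^+ 2 * (c / 8).
  have : (y%:R : R) <= n%:R ^+ 3 * r.+1%:R / a%:R.
    by rewrite ler_pdivlMr ?ltr0n // -natrX -!natrM ler_nat leq_trunc_div.
  move/(ler_wpM2r D0) => hyD.
  rewrite ler_pdivrMr ?mulr_gt0 //; apply: le_trans hyD _.
  rewrite (_ : _ * D = 2 * n%:R ^+ 3 * (r.+1%:R * D / 2 / a%:R)); last first.
    by field; rewrite pnatr_eq0 -lt0n.
  apply: le_trans (ler_wpM2l _ ha) _; first by rewrite mulr_ge0 ?exprn_ge0 ?ler0n.
  by rewrite le_eqVlt; apply/orP; left; apply/eqP; ring.
have hK : K <= n%:R * (c / 2).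
  have c20 : 0 < c / 2 by rewrite divr_gt0.
  have hnN : (N1%:R : R) <= n%:R by rewrite ler_nat.
  by rewrite -(ler_pdivrMr _ _ c20) (le_trans hN1).
have hNK : n%:R * K <= n%:R ^+ 2 * c / 2.
  apply: le_trans (ler_wpM2l (ler0n _ n) hK) _.
  by rewrite le_eqVlt; apply/orP; left; apply/eqP; ring.
have heta : n%:R * (J2%:R * (eta * n%:R - ln eta + lnat R r.+2)) =
   n%:R ^+ 2 * (c / 8) + n%:R * (J2%:R * (lnat R r.+2 - ln eta)).
  by rewrite /eta; field; rewrite gt_eqF.
have hg : n%:R ^+ 2 * g / (2 * q3) = n%:R ^+ 2 * c by rewrite /c; field; rewrite gt_eqF.
have hA2 : n%:R ^+ 2 / 2 * (A - lL) <= n%:R ^+ 2 / 2 * (lnat R m.+1 + c / 4).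
  by rewrite ler_wpM2l ?divr_ge0 ?exprn_ge0 ?ler0n // lerBlDl addrA.
rewrite heta in hE; rewrite hg in bal.
rewrite natr_bin2; move: hNK; rewrite /K -/r.
move: bal hE hk hy hA2; rewrite -/E1.
move: (n%:R ^+ 2) => n2.
move: (lnat R #|_|) (lnat R 4) (lnat R m.+1) (lnat R r.+2) (ln eta) => v1 v2 v3 v4 v5.
move=> *; lra.
Qed.

Lemma short_sum (m a b c : nat) :
  (a < m)%N -> (b < m)%N -> (c <= a + b)%N -> (c <= 2 * m - 2)%N.
Proof. by lia. Qed.

Lemma card_pmet_crowded (R : realType) (m q : nat) : (1 < m)%N -> (0 < q)%N ->
  exists N0 : nat, forall n : nat, (N0 <= n)%N ->
    (#|pmet_crowded n (2 * m) m q| * 2 ^ n <= m.+1 ^ 'C(n, 2))%N.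
Proof.
move=> m1 q0; have [N0 hN0] := card_pmet_on_small R m1 q0.
exists N0 => n hn.
pose big := [set Z : {set 'I_n} | (n <= q * #|Z|)%N].
have sub : pmet_crowded n (2 * m) m q \subset \bigcup_(Z in big) pmet_on (2 * m) Z (2 * m - 2).
  apply/subsetP => d; rewrite inE => /andP [hd /existsP [x hx]].
  apply/bigcupP; exists (small_nbrs m d x); first by rewrite inE.
  rewrite inE hd /=; apply/forall_inP => y; rewrite inE => hy.
  apply/forall_inP => z; rewrite inE => hz.
  have /pmetP [_ _ dt] := hd; have /and3P [_ _ h] := dt x y z.
  exact: short_sum hy hz h.
have h1 : (#|pmet_crowded n (2 * m) m q| * 4 ^ n <= 2 ^ n * m.+1 ^ 'C(n, 2))%N.
  apply: (@leq_trans ((\sum_(Z in big) #|pmet_on (2 * m) Z (2 * m - 2)|) * 4 ^ n)).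
    rewrite leq_mul2r; apply/orP; right; apply: leq_trans (subset_leq_card sub) _.
    elim/big_rec2: _ => [|Z s B _ IH]; first by rewrite cards0.
    by apply: leq_trans (leq_card_setU _ _) _; rewrite leq_add2l.
  rewrite big_distrl /=; apply: (@leq_trans (\sum_(Z in big) m.+1 ^ 'C(n, 2))).
    by apply: leq_sum => Z; rewrite inE => hZ; apply: hN0.
  rewrite sum_nat_const leq_mul2r; apply/orP; right.
  apply: leq_trans (max_card _) _.
  by rewrite -cardsT -powersetT card_powerset cardsT card_ord.
have e4 : (4 ^ n = 2 ^ n * 2 ^ n)%N by rewrite -expnMn.
by move: h1; rewrite e4 mulnA [(2 ^ n * m.+1 ^ _)%N]mulnC leq_pmul2r ?expn_gt0.
Qed.

(** With L twice the alphabet size t, the letters of weight 1 amount to half a good letter: w + 1/2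
    <= v - 1/2 is still below v. *)
Lemma letters_weight (t w v : nat) : (0 < v)%N -> (w <= v - 1)%N ->
  (2 * (2 * t * w + t) <= 2 * t * (2 * v - 1))%N.
Proof.
move=> v0 wv; rewrite (_ : 2 * (2 * t * w + t) = 2 * t * (2 * w + 1))%N; last by lia.
by rewrite leq_mul2l; lia.
Qed.

(** Each remaining point gains a factor (u - 1) / u with u = 2 (m + 1)^2, in all n g. Bad letters
    use n g / 4, the factors n + 2 and n + 1 use n g / 8, the constants in [K] at most n g / 4, and
    the claimed decay n g / 4. *)
Lemma sparse_words_decay (R : realType) (m : nat) : (1 < m)%N ->
  exists (q N0 : nat) (b : R), [/\ (0 < q)%N, 0 < b & forall n : nat, (N0 <= n)%N ->
    (n.+2 * n.+1 * ((2 * m).+1 *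
      #|[set w : {ffun 'I_n -> 'I_(2 * m).+1 * 'I_(2 * m).+1} |
          (q * #|bad_letters (wide_letters m) w| <= 2 * n.+2)%N]|))%:R
      <= (m.+1 ^ (2 * n))%:R * expR (- b * n%:R) :> R].
Proof.
move=> m1; pose rho := (2 * m).+1; pose L := (2 * rho ^ 2)%N; pose u := (2 * m.+1 ^ 2)%N.
have L0 : (0 < L)%N by rewrite muln_gt0 expn_gt0.
have u2 : (2 <= u - 1)%N by rewrite /u; have := expn_gt0 m.+1 2; nia.
have u1 : (0 < u - 1)%N by apply: leq_trans u2.
pose g := lnat R u - lnat R (u - 1).
have g0 : 0 < g by rewrite subr_gt0 /lnat ltr_ln ?posrE ?ltr0n ?ltr_nat; lia.
have [q [q0 hq]] := natr_archi (2 * lnat R L / (g / 4)).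
have g40 : 0 < g / 4 by rewrite divr_gt0.
have {}hq : 2 * lnat R L / q%:R <= g / 4 by apply: ler_pdiv_archi; rewrite ?ltr0n.
have g160 : 0 < g / 16 by rewrite divr_gt0.
pose K := 2 * lnat R 4 + lnat R rho - 2 * ln (g / 16) + 2 * (g / 4).
have [N0 [N00 hN0]] := natr_archi (K / (g / 4)).
exists q, N0, (g / 4); split=> // n hn.
set Wd := [set w | _].
have n0 : (0 < n)%N by apply: leq_trans hn.
have [->|W0] := posnP #|Wd|; first by rewrite !muln0 mulr_ge0 ?ler0n ?expR_ge0.
have hW : (#|Wd| * 2 ^ n <= L ^ (2 * n.+2 %/ q) * (u - 1) ^ n)%N.
  have -> : Wd = [set w | (#|bad_letters (wide_letters m) w| <= 2 * n.+2 %/ q)%N].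
    by apply/setP => w; rewrite !inE leq_divRL // mulnC.
  have := card_sparse_words (wide_letters m) n (2 * n.+2 %/ q) L0.
  set X := #|_| => h.
  rewrite -(leq_pmul2r (m := L ^ n)) ?expn_gt0 ?L0 //.
  apply: (@leq_trans (2 ^ n * (L ^ (2 * n.+2 %/ q) *
    (L * #|wide_letters m| + #|{: 'I_(2 * m).+1 * 'I_(2 * m).+1}|) ^ n))).
    by rewrite mulnAC mulnC leq_mul2l h orbT.
  rewrite mulnCA -[leqRHS]mulnA leq_mul2l; apply/orP; right.
  rewrite -!expnMn leq_exp2r // card_prod !card_ord -/rho.
  by rewrite mulnn [leqRHS]mulnC; apply: letters_weight (card_wide_letters m); rewrite expn_gt0.
set Y := (_ * _)%N.
have Y0 : (0 < Y)%N by rewrite !muln_gt0.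
rewrite -[Y%:R]lnK ?posrE ?ltr0n // -[(m.+1 ^ _)%:R]lnK ?posrE ?ltr0n ?expn_gt0 //.
rewrite -expRD ler_expR -/(lnat R _) -/(lnat R _) lnatX //.
have lnW : lnat R #|Wd| + n%:R * lnat R 2 <= (2 * n.+2 %/ q)%:R * lnat R L + n%:R * lnat R (u - 1).
  by rewrite -!lnatX // -!lnatM ?expn_gt0 ?L0 ?u1 //; apply: ler_lnat; rewrite // muln_gt0 W0 expn_gt0.
have hu : lnat R u = lnat R 2 + 2 * lnat R m.+1.
  by rewrite /u lnatM ?expn_gt0 // lnatX.
have hk : (2 * n.+2 %/ q)%:R * lnat R L <= (n%:R + 2) * (g / 4).
  have l0 : 0 <= lnat R L by apply: lnat_ge0.
  have : ((2 * n.+2 %/ q)%:R : R) <= 2 * (n%:R + 2) / q%:R.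
    rewrite ler_pdivlMr ?ltr0n // -[n%:R + 2]natrD -!natrM ler_nat.
    by apply: leq_trans (leq_trunc_div _ _) _; rewrite addn2.
  move/(ler_wpM2r l0) => /le_trans; apply.
  rewrite (_ : _ * lnat R L = (n%:R + 2) * (2 * lnat R L / q%:R)); last by ring.
  by rewrite ler_wpM2l // addr_ge0 ?ler0n.
have hlin v : (0 < v <= 4 * n)%N -> lnat R v <= lnat R 4 + (g / 16 * n%:R - ln (g / 16)).
  move=> /andP [v0 hv]; apply: le_trans (ler_lnat R v0 hv) _.
  by rewrite lnatM // lerD2l lnat_le_linear.
have hK : K <= n%:R * (g / 4).
  have hnN : (N0%:R : R) <= n%:R by rewrite ler_nat.
  by rewrite -(ler_pdivrMr _ _ g40) (le_trans hN0).
have hY : lnat R Y = lnat R n.+2 + lnat R n.+1 + (lnat R rho + lnat R #|Wd|).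
  by rewrite /Y !lnatM ?muln_gt0.
have h2 : lnat R n.+2 <= lnat R 4 + (g / 16 * n%:R - ln (g / 16)).
  by apply: hlin; clear -n0; lia.
have h1 : lnat R n.+1 <= lnat R 4 + (g / 16 * n%:R - ln (g / 16)).
  by apply: hlin; clear -n0; lia.
have hg : n%:R * g = n%:R * (lnat R 2 + 2 * lnat R m.+1 - lnat R (u - 1)) by rewrite -hu.
have ng0 : 0 <= n%:R * g by rewrite mulr_ge0 ?ler0n // ltW.
rewrite hY natrM; move: ng0 lnW hk h1 h2 hK hg; rewrite /K.
move: (ln (g / 16)) (lnat R 2) (lnat R 4) (lnat R rho) (lnat R #|Wd|) (lnat R (u - 1)).
move: (lnat R m.+1) (lnat R n.+1) (lnat R n.+2) => *; lra.
Qed.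

(** * The recursion for the normalised count *)

Lemma card_pmet_split n r m q :
  (#|pmet n r| <= #|[set d in pmet n r | ~~ has_small_edge m d]| +
    (#|pmet_crowded n r m q| + #|pmet_sparse n r m q|))%N.
Proof.
apply: (@leq_trans #|[set d in pmet n r | ~~ has_small_edge m d] :|:
    (pmet_crowded n r m q :|: pmet_sparse n r m q)|).
  apply: subset_leq_card; apply/subsetP => d dM.
  have i1 : (d \in [set d in pmet n r | ~~ has_small_edge m d]) = ~~ has_small_edge m d.
    by rewrite inE dM.
  have i2 : (d \in pmet_crowded n r m q) = crowded m q d by rewrite inE dM.
  have i3 : (d \in pmet_sparse n r m q) = ~~ crowded m q d && has_small_edge m d.
    by rewrite inE dM.
  by rewrite !in_setU i1 i2 i3; case: has_small_edge => //=; case: crowded.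
apply: leq_trans (leq_card_setU _ _) _; rewrite leq_add2l.
exact: leq_card_setU.
Qed.

Definition pmet_ratio (R : realType) m n : R :=
  #|pmet n (2 * m)|%:R / (m.+1 ^ 'C(n, 2))%:R.

Lemma pmet_ratio_rec (R : realType) (m : nat) : (1 < m)%N ->
  exists (N0 : nat) (b : R), 0 < b /\ forall n : nat, (N0 <= n)%N ->
    pmet_ratio R m n.+2 <= 1 + 2^-1 ^+ n.+2 + pmet_ratio R m n * expR (- b * n%:R).
Proof.
move=> m1; have [q [N1 [b [q0 b0 hN1]]]] := sparse_words_decay R m1.
have [N2 hN2] := card_pmet_crowded R m1 q0.
exists (maxn N1 N2), b; split=> // n; rewrite geq_max => /andP [n1 n2].
have hC : ('C(n.+2, 2) = 'C(n, 2) + (2 * n + 1))%N by rewrite !binS !bin1 bin0; lia.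
have c0 k : (0 : R) < (m.+1 ^ k)%:R by rewrite ltr0n expn_gt0.
rewrite /pmet_ratio ler_pdivrMr //.
apply: le_trans (_ : (#|[set d in pmet n.+2 (2 * m) | ~~ has_small_edge m d]| +
    (#|pmet_crowded n.+2 (2 * m) m q| + #|pmet_sparse n.+2 (2 * m) m q|))%:R <= _).
  by rewrite ler_nat card_pmet_split.
rewrite !natrD addrA 2!mulrDl mul1r; apply: lerD; first apply: lerD.
- rewrite ler_nat; apply: leq_trans (card_pmet_no_small_edge _ _ _) _.
  by rewrite card_upper_pairs (_ : (2 * m).+1 - m = m.+1)%N //; lia.
- rewrite exprVn ler_pdivlMl ?exprn_gt0 // mulrC -natrX -natrM ler_nat.
  by apply: hN2; apply: leq_trans n2 _; rewrite -addn2 leq_addr.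
apply: le_trans (_ : (#|pmet n (2 * m)|)%:R * ((m.+1 ^ (2 * n))%:R * expR (- b * n%:R)) <= _).
  apply: le_trans (ler_wpM2l (ler0n _ _) (hN1 n n1)).
  rewrite -natrM ler_nat; apply: leq_trans (card_pmet_sparse n m q) _.
  by rewrite leq_eqVlt; apply/orP; left; apply/eqP; lia.
rewrite hC [in leRHS]expnD [in leRHS]natrM.
have cancel (X E c d : R) : 0 < c -> X / c * E * (c * d) = X * (d * E).
  by move=> hc; field; rewrite gt_eqF.
rewrite cancel // ler_wpM2l ?ler0n // ler_wpM2r ?expR_ge0 // ler_nat leq_exp2l; last exact: ltnW.
by rewrite leq_addr.
Qed.

Lemma expR_neg_small (R : realType) (b b' C : R) : b' < b -> 0 <= C ->
  exists N : nat, forall n : nat, (N <= n)%N ->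
    C * expR (- b * n%:R) <= expR (- b' * n%:R).
Proof.
move=> bb C0; have d0 : 0 < b - b' by rewrite subr_gt0.
have [N [_ hN]] := natr_archi (C / (b - b')).
exists N => n hn.
have -> : expR (- b' * n%:R) = expR ((b - b') * n%:R) * expR (- b * n%:R).
  by rewrite -expRD; congr expR; ring.
rewrite ler_wpM2r ?expR_ge0 //; apply: le_trans (expR_ge1Dx _).
have hnN : (N%:R : R) <= n%:R by rewrite ler_nat.
have : C <= (b - b') * n%:R by rewrite mulrC -(ler_pdivrMr _ _ d0) (le_trans hN).
lra.
Qed.

(** Two passes. First F is bounded by G: once the exponential is at most 1/4, the right-hand side is
    at most 3/2 + G / 4, which is at most G since G >= 2. Then this bound, put back into the
    recursion, makes its last term exponentially small. *)
Lemma ratio_rec_limit (R : realType) (F : nat -> R) (b : R) (N0 : nat) :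
  (forall n, 0 <= F n) -> 0 < b ->
  (forall n, (N0 <= n)%N ->
     F n.+2 <= 1 + 2^-1 ^+ n.+2 + F n * expR (- b * n%:R)) ->
  exists (beta : R) (M : nat), [/\ 0 < beta, (0 < M)%N &
    forall n, (M <= n)%N -> F n <= 1 + 2 `^ (- beta * n%:R)].
Proof.
move=> F0 b0 rec.
have [N1 hN1] : exists N : nat, forall n : nat, (N <= n)%N ->
    4 * expR (- b * n%:R) <= expR (- 0 * n%:R) by apply: expR_neg_small.
pose N2 := maxn N0 N1.
pose G := 2 + \sum_(i < N2.+2) F i.
have G2 : 2 <= G by rewrite lerDl sumr_ge0.
have bound n : F n <= G.
  elim/ltn_ind: n => n IH; case: (ltnP n N2.+2) => hn.
    rewrite /G (bigD1 (Ordinal hn)) //= addrCA lerDl addr_ge0 // sumr_ge0 //.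
  case: n hn IH => [//|[//|n]]; rewrite !ltnS geq_max => /andP [h0 h1] IH.
  apply: le_trans (rec n h0) _.
  have := hN1 n h1; rewrite oppr0 mul0r expR0 => he.
  have hp : (2^-1 : R) ^+ n.+2 <= 1 by rewrite exprn_ile1 // ?invr_ge0 // invf_le1 ?ler1n.
  have hF : F n * expR (- b * n%:R) <= G * expR (- b * n%:R).
    by rewrite ler_wpM2r ?expR_ge0 // IH //; lia.
  have : G * (4 * expR (- b * n%:R)) <= G * 1 by rewrite ler_wpM2l //; lra.
  have : (2^-1 : R) ^+ n.+2 <= 2^-1.
    rewrite exprS ler_piMr ?invr_ge0 // exprn_ile1 ?invr_ge0 // invf_le1 ?ler1n //.
  by lra.
have ln20 : (0 : R) < ln 2 by rewrite ln_gt0 // ltr1n.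
(* Being below both rates, b' eventually makes each of the two error terms at most half of exp(-b'
   n). The factor exp(2 b) further on absorbs the shift from n to n + 2, and division by ln 2 passes
   to base 2. *)
pose b' := Num.min b (ln 2) / 2.
have m0 : 0 < Num.min b (ln 2) by rewrite lt_min b0 ln20.
have b'0 : 0 < b' by rewrite divr_gt0.
have b'b : b' < b.
  have : Num.min b (ln 2) <= b by rewrite ge_min lexx.
  by rewrite /b'; lra.
have b'l : b' < ln 2.
  have : Num.min b (ln 2) <= ln 2 by rewrite ge_min lexx orbT.
  by rewrite /b'; lra.
have [M1 hM1] := expR_neg_small (C := 2) b'l (ler0n _ _).
have GE0 : 0 <= 2 * (G * expR (2 * b)) by rewrite !mulr_ge0 ?expR_ge0 //; lra.
have [M2 hM2] := expR_neg_small b'b GE0.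
exists (b' / ln 2), (maxn N0.+2 (maxn M1 M2)); split; first by rewrite divr_gt0.
  by rewrite leq_max.
move=> n; rewrite !geq_max => /and3P [h0 h1 h2].
have -> : 2 `^ (- (b' / ln 2) * n%:R) = expR (- b' * n%:R).
  rewrite /powR pnatr_eq0 /=; congr expR; field; by rewrite gt_eqF.
have := hM1 n h1; have := hM2 n h2.
case: n h0 {h1 h2} => [//|[//|n]]; rewrite !ltnS => h0.
have -> : expR (- ln 2 * n.+2%:R) = (2^-1 : R) ^+ n.+2.
  by rewrite mulrC expRM_natl expRN lnK // posrE.
have -> : 2 * (G * expR (2 * b)) * expR (- b * n.+2%:R) = 2 * (G * expR (- b * n%:R)).
  rewrite -!mulrA; congr (_ * (_ * _)); rewrite -expRD; congr expR.
  by rewrite -[n.+2]addn2 natrD; ring.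
move=> e1 e2.
have hF : F n * expR (- b * n%:R) <= G * expR (- b * n%:R).
  by rewrite ler_wpM2r ?expR_ge0.
by have := rec n h0; lra.
Qed.

(** * Back to r-graphs *)

Lemma card_edge n : #|{: edge 'I_n}| = 'C(n, 2).
Proof.
rewrite card_sig -[in RHS](card_ord n) -card_draws -cardsE.
by apply: eq_card => e; rewrite !inE.
Qed.

Lemma card_upper_rgraphs_ge (m n : nat) : (0 < m)%N ->
  (m.+1 ^ 'C(n, 2) <= #|upper_rgraphs (2 * m) n|)%N.
Proof.
move=> m0; have r0 : (0 < 2 * m)%N by rewrite muln_gt0.
(* The ordinal k stands for the colour k + 1, so the colours m, ..., 2m are the ordinals m - 1 +
   i. *)
have hk (i : 'I_m.+1) : (m.-1 + i < 2 * m)%N by have := ltn_ord i; lia.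
pose g (f : {ffun edge 'I_n -> 'I_m.+1}) : Defs.rgraph (2 * m) 'I_n :=
  [ffun e => [set Ordinal (hk (f e))]].
have ginj : injective g.
  move=> f f' /ffunP h; apply/ffunP => e; have := h e; rewrite !ffunE => /set1_inj [] /addnI.
  exact: val_inj.
rewrite -(card_edge n) -[m.+1]card_ord -card_ffun -cardsT -(card_imset _ ginj).
apply: subset_leq_card; apply/subsetP => _ /imsetP [f _ ->]; rewrite inE; apply/and3P; split.
- by apply/forallP => e; rewrite ffunE cards1.
- by apply/forallP => e; rewrite ffunE; apply/set0Pn; exists (Ordinal (hk (f e))); rewrite inE.
apply/forallP => e; rewrite ffunE sub1set inE /colour_val /= mul2n doubleK -addSn prednK //.
by rewrite leq_addr -addnn leq_add2l -ltnS ltn_ord.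
Qed.

(** Distances are stored unshifted here, with 0 left for the diagonal; [inord] is exact because of
    [rg_dist_le]. *)
Definition dist_fun r n (G : Defs.rgraph r 'I_n) : {ffun 'I_n * 'I_n -> 'I_r.+1} :=
  [ffun p => inord (rg_dist G p.1 p.2)].

Lemma rg_dist_le r n (G : Defs.rgraph r 'I_n) x y : (rg_dist G x y <= r)%N.
Proof. by rewrite /rg_dist; case: pickP => // k _; rewrite /colour_val. Qed.

Lemma rg_distC r n (G : Defs.rgraph r 'I_n) x y : rg_dist G x y = rg_dist G y x.
Proof. by rewrite /rg_dist /rg_colours setUC. Qed.

Lemma rg_dist_diag r n (G : Defs.rgraph r 'I_n) x : rg_dist G x x = 0%N.
Proof.
rewrite /rg_dist; case: pickP => // k; rewrite /rg_colours.
by case: insubP => [e|_]; rewrite ?inE // setUid cards1.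
Qed.

Lemma dist_fun_inj r n :
  {in [pred G : Defs.rgraph r 'I_n | rg_simple G && rg_complete G] &, injective (@dist_fun r n)}.
Proof.
move=> G G' /andP [/forallP sG /forallP cG] /andP [/forallP sG' /forallP cG'] /ffunP h.
have single (H : Defs.rgraph r 'I_n) (e : edge 'I_n) : (#|H e| <= 1)%N -> H e != set0 ->
    exists k, H e = [set k].
  move=> h1 h2; apply/cards1P; rewrite eqn_leq h1 lt0n cards_eq0 h2 //.
apply/ffunP => e.
have [k hk] := single G e (sG e) (cG e); have [k' hk'] := single G' e (sG' e) (cG' e).
have /cards2P [x [y [_ he]]] := valP e.
have := h (x, y); rewrite !ffunE /= => /(congr1 (@nat_of_ord _)).
rewrite !inordK ?ltnS ?rg_dist_le // /rg_dist /rg_colours -he valK hk hk'.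
case: pickP => [i|/(_ k)]; rewrite inE ?eqxx // => /eqP ->.
case: pickP => [j|/(_ k')]; rewrite inE ?eqxx // => /eqP ->.
by rewrite /colour_val => -[/val_inj ->].
Qed.

Lemma card_metric_rgraphs_le r n : (#|metric_rgraphs r n| <= #|pmet n r|)%N.
Proof.
have inj : {in metric_rgraphs r n &, injective (@dist_fun r n)}.
  move=> G G'; rewrite !inE => /and3P [s c _] /and3P [s' c' _].
  by apply: dist_fun_inj; rewrite inE ?s ?s'.
rewrite -(card_in_imset inj); apply: subset_leq_card; apply/subsetP => _ /imsetP [G hG ->].
move: hG; rewrite inE => /and3P [_ _ ht].
(* Metric r-graphs are constrained on distinct points only; coinciding points are settled by the
   zero diagonal or by a repeated summand. *)
have t x y z : (rg_dist G x z <= rg_dist G x y + rg_dist G y z)%N.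
  have [->|xy] := eqVneq x y; first by rewrite leq_addl.
  have [->|yz] := eqVneq y z; first by rewrite leq_addr.
  have [->|xz] := eqVneq x z; first by rewrite rg_dist_diag.
  move/forallP: ht => /(_ x) /forallP /(_ y) /forallP /(_ z).
  by rewrite xy yz xz.
apply/pmetP; split=> [x|x y|x y z]; rewrite !ffunE /=.
- by rewrite rg_dist_diag; apply: val_inj; rewrite /= inordK.
- by rewrite rg_distC.
rewrite !inordK ?ltnS ?rg_dist_le // /tri; apply/and3P; split.
- by rewrite [rg_dist G y z]rg_distC.
- exact: t.
by rewrite [rg_dist G x y]rg_distC.
Qed.

Theorem theorem1p2 (R : realType) (r : nat) (r_ge4 : (4 <= r)%N)
    (r_even : ~~ odd r) :
  exists (beta : R) (M : nat), [/\ 0 < beta, (0 < M)%N &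
    forall n : nat, (M <= n)%N ->
      #|upper_rgraphs r n|%:R >=
        #|metric_rgraphs r n|%:R * (1 - 2 `^ (- beta * n%:R)) :> R].
Proof.
pose m := r./2.
have rE : r = (2 * m)%N by rewrite /m; lia.
have m1 : (1 < m)%N by rewrite /m; lia.
have [N0 [b [b0 rec]]] := pmet_ratio_rec R m1.
have F0 n : 0 <= pmet_ratio R m n by rewrite divr_ge0 ?ler0n.
have [beta [M [beta0 M0 hM]]] := ratio_rec_limit F0 b0 rec.
exists beta, M; split=> // n hn; rewrite rE.
set eps := 2 `^ _.
have eps0 : 0 <= eps by apply: powR_ge0.
have eps1 : eps <= 1.
  rewrite -[leRHS](powRr0 2) ler_powR ?ler1n //.
  by rewrite mulNr oppr_le0 mulr_ge0 ?ler0n // ltW.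
have c0 : (0 : R) < (m.+1 ^ 'C(n, 2))%:R by rewrite ltr0n expn_gt0.
have hmet : (#|metric_rgraphs (2 * m) n|%:R : R) <= (m.+1 ^ 'C(n, 2))%:R * (1 + eps).
  apply: le_trans (_ : #|pmet n (2 * m)|%:R <= _); first by rewrite ler_nat card_metric_rgraphs_le.
  by have := hM n hn; rewrite /pmet_ratio ler_pdivrMr // mulrC.
apply: le_trans (_ : (m.+1 ^ 'C(n, 2))%:R <= _); last by rewrite ler_nat card_upper_rgraphs_ge // ltnW.
have e1 : 0 <= 1 - eps by rewrite subr_ge0.
(* What remains is (1 + eps) (1 - eps) = 1 - eps^2 <= 1. *)
apply: le_trans (ler_wpM2r e1 hmet) _.
rewrite -mulrA -[leRHS]mulr1 ler_wpM2l ?(ltW c0) //.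
have : 0 <= eps * eps by rewrite mulr_ge0.
lra.
Qed.
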